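(* For any integer $c\ge 2$ and any complex $s$ with $\operatorname{Re}(s)>0$, $$e^{\zeta_{(c)}'(s)}=\prod_{n=1}^{\infty}n^{\frac{(-1)a_{c,n}}{n^s}}.$$
   Context: $\zeta_{(c)}(s)=(1-c^{1-s})\zeta(s)$, where $\zeta$ is the (meromorphically continued) Riemann zeta function; $\zeta_{(c)}$ is an entire function (the singularity at $s=1$ is removable) and $\zeta_{(c)}'$ is its derivative. For integers $n\ge1$, $a_{c,n}=1-c$ if $n\equiv 0\pmod c$ and $a_{c,n}=1$ otherwise. For a positive integer $n$ and complex $w$, $n^w=e^{w\log n}$ with the real logarithm. The infinite product means the limit of the partial products $\prod_{n=1}^{M}$ as $M\to\infty$. *)

(* Defs.v *)
(* Stdlib world: Stdlib's reals with Coquelicot's complex numbers. *)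
From Stdlib Require Import Reals Arith.
From Coquelicot Require Import Coquelicot.
Open Scope C_scope.

Definition Cexp (z : C) : C :=
  (exp (Re z) * cos (Im z), exp (Re z) * sin (Im z))%R.

(* Meaningful only for n >= 1, since Stdlib's [ln 0] is a junk value. *)
Definition nat_Cpow (n : nat) (w : C) : C := Cexp (w * RtoC (ln (INR n))).

(* Differentiability is complex: scalars are taken in [C_AbsRing]. *)
Definition holomorphic_at (f : C -> C) (z : C) : Prop :=
  @ex_derive C_AbsRing C_NormedModule f z.

Definition meromorphic_at (f : C -> C) (p : C) : Prop :=
  exists (k : nat) (r : R) (h : C -> C),
    (0 < r)%R /\
    forall z : C, (Cmod (z - p) < r)%R ->
      holomorphic_at h z /\ (z <> p -> h z = (z - p) ^ k * f z).

(* The meromorphic continuation of the Dirichlet series to the whole plane,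
   with no pole away from 1.  By the identity theorem this determines [zeta]
   everywhere except for its value at 1, which is left arbitrary. *)
Definition is_riemann_zeta (zeta : C -> C) : Prop :=
  (forall s : C, s <> RtoC 1 -> holomorphic_at zeta s) /\
  meromorphic_at zeta (RtoC 1) /\
  (forall s : C, (1 < Re s)%R ->
     @is_series C_AbsRing C_NormedModule
       (fun k : nat => / nat_Cpow (S k) s) (zeta s)).

(* At 1 the function is given its limit.  Coquelicot's [C_lim] computes it
   along the horizontal line through 1, and agrees with the full complex limit
   whenever that exists ([is_C_lim_unique]). *)
Definition zeta_c (zeta : C -> C) (c : nat) (s : C) : C :=
  let F := fun z : C => (1 - nat_Cpow c (1 - z)) * zeta z in
  if Ceq_dec s (RtoC 1) then C_lim F (RtoC 1) else F s.

Definition a_coef (c n : nat) : R :=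
  if (n mod c =? 0)%nat then (1 - INR c)%R else 1%R.

(* The product of f 1, ..., f M; the value f 0 is not used. *)
Fixpoint partial_prod (f : nat -> C) (M : nat) : C :=
  match M with
  | O => 1
  | S m => partial_prod f m * f (S m)
  end.

Definition is_infinite_prod (f : nat -> C) (l : C) : Prop :=
  filterlim (partial_prod f) eventually (@locally C_UniformSpace l).

(* Main.v *)
Require Import Defs.
From Stdlib Require Import Reals Arith Lra Lia.
From Coquelicot Require Import Coquelicot.
Open Scope C_scope.

(** The partial sums of the coefficients a_{c,n} are the residues n mod c, hence
    bounded, although the coefficients do not tend to 0.  Summation by parts
    therefore makes D(s) = sum a_{c,n} n^{-s} converge for every s with Re s > 0,
    and the same estimate, applied to the second order Taylor remainder
    n^{-s-h} - n^{-s} + h (log n) n^{-s}, bounds the remainder of the whole series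
    by a constant times |h|^2.  So D is holomorphic on the half plane and
    D'(s) = - sum a_{c,n} (log n) n^{-s}, with ordinary convergence of the partial
    sums ([dirichlet_series_derive]).  The partial products of the theorem are the
    exponentials of these partial sums; it only remains to see that
    zeta_(c) = D on Re s > 0.

    For Re s > 1, subtracting c times the terms at multiples of c from the series of
    zeta gives D(s) = (1 - c^{1-s}) zeta(s) ([dirichlet_series_zeta_c_coef]).  This
    identity has to be carried to Re s > 0 from the complex differentiability of zeta
    off 1 and the finite order of its pole at 1.  Multiplying the difference of both
    sides by a power of s - 1 gives a function that is differentiable at each point
    of the half plane and vanishes for Re s > 1; the identity theorem needed is
    [half_plane_identity].

    The identity theorem is obtained without power series.  Goursat's bisection
    argument shows that contour integrals over rectangles vanish ([goursat]), and
    the Cauchy kernel then bounds a function at the centre of a square by twice its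
    maximum over the boundary ([center_bound]).  If H vanishes near p, then
    H(z) / (z - p)^n is again differentiable for every n; when z is closer to p than
    the boundary of a square around z is, letting n grow forces H(z) = 0
    ([vanishing_step]).  Repeating this moves the zero set to the left, from Re s > 1
    over the whole half plane.

    Only the imaginary part of a contour integral is ever used, because the integral
    of 1/z around the origin is purely imaginary.  All integrals are thus integrals
    of real functions. *)

(** * Complex differentiability at a point *)

(** The field C is a normed module over itself in two ways, with the same norm but
    different balls.  The derivative depends on the norm alone. *)
Lemma is_derive_C_ring (f : C -> C) (z l : C) :
  @is_derive C_AbsRing C_NormedModule f z l <->
  @is_derive C_AbsRing (AbsRing_NormedModule C_AbsRing) f z l.
Proof.
  split; intros [_ H]; (split; [apply is_linear_scal_l | exact H]).
Qed.

Lemma is_derive_C (f : C -> C) (z l : C) :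
  @is_derive C_AbsRing C_NormedModule f z l <->
  forall eps : R, (0 < eps)%R -> exists d : R, (0 < d)%R /\
    forall w : C, (Cmod (w - z) < d)%R ->
      (Cmod (f w - f z - l * (w - z)) <= eps * Cmod (w - z))%R.
Proof.
  split.
  - intros [_ H] eps Heps.
    destruct (H z (fun P HP => HP) (mkposreal eps Heps)) as [d Hd].
    exists d; split; [apply cond_pos|].
    intros w Hw. specialize (Hd w Hw).
    replace (l * (w - z)) with ((w - z) * l) by ring. exact Hd.
  - intros H; split; [apply is_linear_scal_l|].
    intros x Hx eps.
    assert (x = z) as ->.
    { symmetry. apply (is_filter_lim_locally_unique (K := C_AbsRing) (V := AbsRing_NormedModule C_AbsRing) z x Hx). }
    destruct (H eps (cond_pos eps)) as [d [d0 Hd]].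
    exists (mkposreal d d0). intros w Hw. specialize (Hd w Hw).
    replace (l * (w - z)) with ((w - z) * l) in Hd by ring. exact Hd.
Qed.

Lemma holomorphic_at_continuous (f : C -> C) (z : C) :
  holomorphic_at f z ->
  forall eps : R, (0 < eps)%R -> exists d : R, (0 < d)%R /\
    forall w : C, (Cmod (w - z) < d)%R -> (Cmod (f w - f z) < eps)%R.
Proof.
  intros [l H] eps Heps. pose proof (proj1 (is_derive_C f z l) H) as H1; clear H; rename H1 into H.
  destruct (H 1%R Rlt_0_1) as [d [Hd0 Hd]].
  assert (Hl := Cmod_ge_0 l).
  exists (Rmin d (eps / (Cmod l + 2))). split.
  - apply Rmin_glb_lt; [assumption | apply Rdiv_lt_0_compat; lra].
  - intros w Hw.
    assert (H1 : (Cmod (w - z) < d)%R) by (eapply Rlt_le_trans; [exact Hw | apply Rmin_l]).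
    assert (H2 : (Cmod (w - z) < eps / (Cmod l + 2))%R) by (eapply Rlt_le_trans; [exact Hw | apply Rmin_r]).
    specialize (Hd w H1).
    replace (f w - f z) with ((f w - f z - l * (w - z)) + l * (w - z)) by ring.
    eapply Rle_lt_trans; [apply Cmod_triangle|]. rewrite Cmod_mult.
    apply Rmult_lt_compat_r with (r := (Cmod l + 2)%R) in H2; [|lra].
    replace (eps / (Cmod l + 2) * (Cmod l + 2))%R with eps in H2 by (field; lra).
    assert (H3 := Cmod_ge_0 (w - z)). nra.
Qed.

Lemma holomorphic_at_ext_loc (f g : C -> C) (z : C) (d : R) :
  (0 < d)%R -> (forall w, (Cmod (w - z) < d)%R -> f w = g w) ->
  holomorphic_at f z -> holomorphic_at g z.
Proof.
  intros Hd Hfg. apply ex_derive_ext_loc. exists (mkposreal d Hd). exact Hfg.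
Qed.

Lemma holomorphic_at_const (a z : C) : holomorphic_at (fun _ => a) z.
Proof. apply ex_derive_const. Qed.

Lemma holomorphic_at_id (z : C) : holomorphic_at (fun w => w) z.
Proof. exists (RtoC 1). apply (is_derive_C_ring (fun w => w) z 1), (is_derive_id (K := C_AbsRing)). Qed.

Lemma holomorphic_at_minus (f g : C -> C) (z : C) :
  holomorphic_at f z -> holomorphic_at g z -> holomorphic_at (fun w => f w - g w) z.
Proof. apply (ex_derive_minus (V := C_NormedModule)). Qed.

Lemma holomorphic_at_mult (f g : C -> C) (z : C) :
  holomorphic_at f z -> holomorphic_at g z -> holomorphic_at (fun w => f w * g w) z.
Proof.
  intros [l Hf] [m Hg]. exists (l * g z + f z * m).
  apply (is_derive_C_ring _ z). apply (is_derive_C_ring f z l) in Hf.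
  apply (is_derive_C_ring g z m) in Hg.
  exact (is_derive_mult (K := C_AbsRing) f g z l m Hf Hg Cmult_comm).
Qed.

Lemma holomorphic_at_comp (f g : C -> C) (z : C) :
  holomorphic_at f (g z) -> holomorphic_at g z -> holomorphic_at (fun w => f (g w)) z.
Proof.
  intros Hf [m Hg]. apply (is_derive_C_ring g z m) in Hg.
  apply (ex_derive_comp (V := C_NormedModule)); [exact Hf | exists m; exact Hg].
Qed.

Lemma holomorphic_at_pow (f : C -> C) (z : C) (n : nat) :
  holomorphic_at f z -> holomorphic_at (fun w => f w ^ n) z.
Proof.
  intros Hf. induction n as [|n IH]; simpl.
  - apply holomorphic_at_const.
  - apply holomorphic_at_mult; assumption.
Qed.

Lemma holomorphic_at_inv (z : C) : z <> 0 -> holomorphic_at Cinv z.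
Proof.
  intros Hz. exists (- / (z * z)). apply (is_derive_C Cinv z). intros eps Heps.
  assert (Hm : (0 < Cmod z)%R) by (apply Cmod_gt_0; exact Hz).
  set (m := Cmod z) in *.
  exists (Rmin (m / 2) (eps * m ^ 3 / 2)). split.
  - apply Rmin_glb_lt; [lra|].
    assert (0 < m ^ 3)%R by (apply pow_lt; exact Hm). nra.
  - intros w Hw.
    assert (H1 : (Cmod (w - z) < m / 2)%R) by (eapply Rlt_le_trans; [exact Hw | apply Rmin_l]).
    assert (H2 : (Cmod (w - z) < eps * m ^ 3 / 2)%R) by (eapply Rlt_le_trans; [exact Hw | apply Rmin_r]).
    assert (Hmw : (m / 2 < Cmod w)%R).
    { assert (T := Cmod_triangle w (z - w)).
      replace (w + (z - w)) with z in T by ring.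
      rewrite <- (Cmod_opp (z - w)) in T.
      replace (- (z - w)) with (w - z) in T by ring. fold m in T. lra. }
    assert (Hw0 : w <> 0) by (apply Cmod_gt_0; lra).
    replace (/ w - / z - - / (z * z) * (w - z)) with ((w - z) * ((w - z) / (w * (z * z))))
      by (field; auto).
    rewrite Cmod_mult, Rmult_comm.
    apply Rmult_le_compat_r; [apply Cmod_ge_0|].
    rewrite Cmod_div by (repeat apply Cmult_neq_0; assumption).
    rewrite !Cmod_mult. fold m.
    assert (Hp : (0 < Cmod w * (m * m))%R) by (apply Rmult_lt_0_compat; nra).
    apply Rmult_le_reg_r with (Cmod w * (m * m))%R; [exact Hp|].
    replace (Cmod (w - z) / (Cmod w * (m * m)) * (Cmod w * (m * m)))%R with (Cmod (w - z)) by (field; lra).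
    apply Rle_trans with (eps * (m / 2 * (m * m)))%R; [lra|].
    apply Rmult_le_compat_l; [lra|]. apply Rmult_le_compat_r; nra.
Qed.

Lemma holomorphic_at_div (f g : C -> C) (z : C) :
  g z <> 0 -> holomorphic_at f z -> holomorphic_at g z ->
  holomorphic_at (fun w => f w / g w) z.
Proof.
  intros Hz Hf Hg. unfold Cdiv. apply holomorphic_at_mult; [exact Hf|].
  apply (holomorphic_at_comp Cinv g); [apply holomorphic_at_inv; exact Hz | exact Hg].
Qed.

Open Scope R_scope.

(** * Contour integrals over rectangles *)

Lemma im_le_Cmod (z : C) : Rabs (Im z) <= Cmod z.
Proof. eapply Rle_trans; [apply Rmax_r | apply (Rmax_Cmod z)]. Qed.

Lemma Cmod_le_Rabs (x y : R) : Cmod (x, y) <= Rabs x + Rabs y.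
Proof.
  replace ((x, y) : C) with (RtoC x + (RtoC y * Ci))%C
    by (unfold Ci, RtoC, Cplus, Cmult; simpl; f_equal; ring).
  eapply Rle_trans; [apply Cmod_triangle|].
  rewrite Cmod_mult, Cmod_Ci, !Cmod_R. lra.
Qed.

Lemma RInt_between (g : R -> R) (a b m M : R) :
  a <= b -> ex_RInt g a b -> (forall t, a <= t <= b -> m <= g t <= M) ->
  m * (b - a) <= RInt g a b <= M * (b - a).
Proof.
  intros Hab Hg Hb.
  assert (E : forall k : R, k * (b - a) = RInt (fun _ => k) a b).
  { intros k. rewrite RInt_const. unfold scal; simpl; unfold mult; simpl. ring. }
  rewrite !E. split.
  - apply RInt_le; [assumption | apply ex_RInt_const | assumption |].
    intros t Ht; apply Hb; lra.
  - apply RInt_le; [assumption | assumption | apply ex_RInt_const |].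
    intros t Ht; apply Hb; lra.
Qed.

Lemma holomorphic_at_horizontal (f : C -> C) (x y : R) :
  holomorphic_at f (x, y) ->
  continuous (fun t : R => Re (f (t, y))) x /\ continuous (fun t : R => Im (f (t, y))) x.
Proof.
  intros H; split; apply filterlim_locally; intros eps;
  destruct (holomorphic_at_continuous f (x, y) H eps (cond_pos eps)) as [d [Hd0 Hd]];
  exists (mkposreal d Hd0); intros t Ht;
  (assert (Hm : Cmod (f (t, y) - f (x, y)) < eps);
  [ apply Hd; replace (((t, y) - (x, y))%C) with (RtoC (t - x))
      by (unfold RtoC, Cminus, Cplus, Copp; simpl; f_equal; ring);
    rewrite Cmod_R; exact Ht |]);
  (eapply Rle_lt_trans; [| exact Hm]).
  - exact (re_le_Cmod (f (t, y) - f (x, y))).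
  - exact (im_le_Cmod (f (t, y) - f (x, y))).
Qed.

Lemma holomorphic_at_vertical (f : C -> C) (x y : R) :
  holomorphic_at f (x, y) ->
  continuous (fun t : R => Re (f (x, t))) y /\ continuous (fun t : R => Im (f (x, t))) y.
Proof.
  intros H; split; apply filterlim_locally; intros eps;
  destruct (holomorphic_at_continuous f (x, y) H eps (cond_pos eps)) as [d [Hd0 Hd]];
  exists (mkposreal d Hd0); intros t Ht;
  (assert (Hm : Cmod (f (x, t) - f (x, y)) < eps);
  [ apply Hd; replace (((x, t) - (x, y))%C) with (RtoC (t - y) * Ci)%C
      by (unfold RtoC, Ci, Cmult, Cminus, Cplus, Copp; simpl; f_equal; ring);
    rewrite Cmod_mult, Cmod_Ci, Cmod_R, Rmult_1_r; exact Ht |]);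
  (eapply Rle_lt_trans; [| exact Hm]).
  - exact (re_le_Cmod (f (x, t) - f (x, y))).
  - exact (im_le_Cmod (f (x, t) - f (x, y))).
Qed.

Definition holomorphic_on_rect (f : C -> C) (x0 x1 y0 y1 : R) : Prop :=
  forall x y : R, x0 <= x <= x1 -> y0 <= y <= y1 -> holomorphic_at f (x, y).

(** The imaginary part of the counterclockwise contour integral of f over the
    boundary of [x0, x1] x [y0, y1].  Opposite sides share one integral, so that for
    nearly affine f the integrands are nearly constant. *)
Definition im_contour (f : C -> C) (x0 x1 y0 y1 : R) : R :=
  RInt (fun x => Im (f (x, y0)) - Im (f (x, y1))) x0 x1 +
  RInt (fun y => Re (f (x1, y)) - Re (f (x0, y))) y0 y1.

Lemma ex_RInt_horizontal (f : C -> C) (y0 y1 a b : R) :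
  a <= b -> (forall x, a <= x <= b -> holomorphic_at f (x, y0) /\ holomorphic_at f (x, y1)) ->
  ex_RInt (fun x => Im (f (x, y0)) - Im (f (x, y1))) a b.
Proof.
  intros Hab H. apply (ex_RInt_continuous (V := R_CompleteNormedModule)).
  rewrite Rmin_left, Rmax_right by assumption. intros z Hz.
  destruct (H z Hz) as [H0 H1].
  apply (continuous_minus (V := R_NormedModule));
  apply holomorphic_at_horizontal; assumption.
Qed.

Lemma ex_RInt_vertical (f : C -> C) (x0 x1 a b : R) :
  a <= b -> (forall y, a <= y <= b -> holomorphic_at f (x0, y) /\ holomorphic_at f (x1, y)) ->
  ex_RInt (fun y => Re (f (x1, y)) - Re (f (x0, y))) a b.
Proof.
  intros Hab H. apply (ex_RInt_continuous (V := R_CompleteNormedModule)).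
  rewrite Rmin_left, Rmax_right by assumption. intros z Hz.
  destruct (H z Hz) as [H0 H1].
  apply (continuous_minus (V := R_NormedModule));
  apply holomorphic_at_vertical; assumption.
Qed.

Lemma im_contour_split_x (f : C -> C) (x0 x1 x2 y0 y1 : R) :
  x0 <= x1 <= x2 -> y0 <= y1 -> (forall x, x0 <= x <= x2 ->
    holomorphic_at f (x, y0) /\ holomorphic_at f (x, y1)) ->
  (forall y, y0 <= y <= y1 -> holomorphic_at f (x0, y) /\ holomorphic_at f (x1, y)
    /\ holomorphic_at f (x2, y)) ->
  im_contour f x0 x2 y0 y1 = im_contour f x0 x1 y0 y1 + im_contour f x1 x2 y0 y1.
Proof.
  intros Hx Hy Hh Hv. unfold im_contour.
  rewrite <- (RInt_Chasles (V := R_CompleteNormedModule) _ x0 x1 x2);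
    try (apply ex_RInt_horizontal; [lra | intros; apply Hh; lra]).
  assert (E : RInt (fun y => Re (f (x2, y)) - Re (f (x0, y))) y0 y1 =
    RInt (fun y => Re (f (x1, y)) - Re (f (x0, y))) y0 y1 +
    RInt (fun y => Re (f (x2, y)) - Re (f (x1, y))) y0 y1).
  { symmetry. etransitivity.
    - symmetry. apply (RInt_plus (V := R_CompleteNormedModule));
        (apply ex_RInt_vertical; [lra | intros y' Hy'; destruct (Hv y' Hy') as (?&?&?); auto]).
    - apply RInt_ext. intros y' _. unfold plus; simpl. ring. }
  rewrite E. unfold plus; simpl. ring.
Qed.

Lemma im_contour_split_y (f : C -> C) (x0 x1 y0 y1 y2 : R) :
  y0 <= y1 <= y2 -> x0 <= x1 -> (forall y, y0 <= y <= y2 ->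
    holomorphic_at f (x0, y) /\ holomorphic_at f (x1, y)) ->
  (forall x, x0 <= x <= x1 -> holomorphic_at f (x, y0) /\ holomorphic_at f (x, y1)
    /\ holomorphic_at f (x, y2)) ->
  im_contour f x0 x1 y0 y2 = im_contour f x0 x1 y0 y1 + im_contour f x0 x1 y1 y2.
Proof.
  intros Hy Hx Hv Hh. unfold im_contour.
  rewrite <- (RInt_Chasles (V := R_CompleteNormedModule)
    (fun y => Re (f (x1, y)) - Re (f (x0, y))) y0 y1 y2);
    try (apply ex_RInt_vertical; [lra | intros; apply Hv; lra]).
  assert (E : RInt (fun x => Im (f (x, y0)) - Im (f (x, y2))) x0 x1 =
    RInt (fun x => Im (f (x, y0)) - Im (f (x, y1))) x0 x1 +
    RInt (fun x => Im (f (x, y1)) - Im (f (x, y2))) x0 x1).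
  { symmetry. etransitivity.
    - symmetry. apply (RInt_plus (V := R_CompleteNormedModule));
        (apply ex_RInt_horizontal; [lra | intros x' Hx'; destruct (Hh x' Hx') as (?&?&?); auto]).
    - apply RInt_ext. intros x' _. unfold plus; simpl. ring. }
  rewrite E. unfold plus; simpl. ring.
Qed.

(** An affine function contributes nothing, since the two integrals of its constant
    differences cancel; what is left is o(w + h) integrated over a length of order
    w + h. *)
Lemma im_contour_small (f : C -> C) (a b eps : R) :
  holomorphic_at f (a, b) -> 0 < eps ->
  exists d : R, 0 < d /\ forall x y w h : R, x <= a <= x + w -> y <= b <= y + h ->
    w + h < d -> holomorphic_on_rect f x (x + w) y (y + h) ->
    Rabs (im_contour f x (x + w) y (y + h)) <= eps * (w + h) ^ 2.
Proof.
  intros [l Hl] Heps. pose proof (proj1 (is_derive_C f (a, b) l) Hl) as H.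
  (* each integrand is a difference of two values, hence the factor one half *)
  destruct (H (eps / 2)) as [d [Hd0 Hd]]; [lra|].
  exists d; split; [exact Hd0|]. intros x y w h Hx Hy Hwh Hf.
  assert (Hrem : forall u v, x <= u <= x + w -> y <= v <= y + h ->
    Cmod (f (u, v) - f (a, b) - l * ((u, v) - (a, b)))%C <= eps / 2 * (w + h)).
  { intros u v Hu Hv.
    assert (Hm : Cmod ((u, v) - (a, b)) <= w + h).
    { replace ((u, v) - (a, b))%C with ((u - a, v - b) : C)
        by (unfold Cminus, Cplus, Copp; simpl; reflexivity).
      eapply Rle_trans; [apply Cmod_le_Rabs|].
      apply Rplus_le_compat; apply Rabs_le; lra. }
    eapply Rle_trans; [apply Hd; lra|]. apply Rmult_le_compat_l; lra. }
  unfold im_contour. destruct l as [l1 l2].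
  assert (Hi : forall u v, Im ((f (u, v) - f (a, b) - (l1, l2) * ((u, v) - (a, b)))%C)
     = Im (f (u, v)) - Im (f (a, b)) - l1 * (v - b) - l2 * (u - a)).
  { intros u v. unfold Im, Cminus, Cplus, Copp, Cmult; simpl. ring. }
  assert (Hr : forall u v, Re ((f (u, v) - f (a, b) - (l1, l2) * ((u, v) - (a, b)))%C)
     = Re (f (u, v)) - Re (f (a, b)) - l1 * (u - a) + l2 * (v - b)).
  { intros u v. unfold Re, Cminus, Cplus, Copp, Cmult; simpl. ring. }
  assert (Hri : forall u v, x <= u <= x + w -> y <= v <= y + h ->
     Rabs (Re (f (u, v)) - Re (f (a, b)) - l1 * (u - a) + l2 * (v - b)) <= eps / 2 * (w + h) /\
     Rabs (Im (f (u, v)) - Im (f (a, b)) - l1 * (v - b) - l2 * (u - a)) <= eps / 2 * (w + h)).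
  { intros u v Hu Hv. specialize (Hrem u v Hu Hv). rewrite <- Hi, <- Hr.
    split; (eapply Rle_trans; [| exact Hrem]); [apply re_le_Cmod | apply im_le_Cmod]. }
  assert (B1 : (- l1 * h - eps * (w + h)) * (x + w - x) <=
     RInt (fun u => Im (f (u, y)) - Im (f (u, y + h))) x (x + w) <=
     (- l1 * h + eps * (w + h)) * (x + w - x)).
  { apply RInt_between; [lra | apply ex_RInt_horizontal; [lra | intros u Hu; split; apply Hf; lra] |].
    intros u Hu.
    destruct (Hri u y) as [_ A1]; [lra | lra |].
    destruct (Hri u (y + h)) as [_ A2]; [lra | lra |].
    apply Rabs_le_between in A1. apply Rabs_le_between in A2. nra. }
  assert (B2 : (l1 * w - eps * (w + h)) * (y + h - y) <=
     RInt (fun v => Re (f (x + w, v)) - Re (f (x, v))) y (y + h) <=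
     (l1 * w + eps * (w + h)) * (y + h - y)).
  { apply RInt_between; [lra | apply ex_RInt_vertical; [lra | intros u Hu; split; apply Hf; lra] |].
    intros v Hv.
    destruct (Hri x v) as [A1 _]; [lra | lra |].
    destruct (Hri (x + w) v) as [A2 _]; [lra | lra |].
    apply Rabs_le_between in A1. apply Rabs_le_between in A2. nra. }
  apply Rabs_le. nra.
Qed.

(** * Goursat's theorem *)

Lemma im_contour_quarters (f : C -> C) (x y w h : R) :
  0 <= w -> 0 <= h -> holomorphic_on_rect f x (x + 2 * w) y (y + 2 * h) ->
  im_contour f x (x + 2 * w) y (y + 2 * h) =
    im_contour f x (x + w) y (y + h) +
    im_contour f (x + w) (x + w + w) y (y + h) +
    im_contour f x (x + w) (y + h) (y + h + h) +
    im_contour f (x + w) (x + w + w) (y + h) (y + h + h).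
Proof.
  intros Hw Hh Hf.
  replace (x + 2 * w) with (x + w + w) in * by ring.
  replace (y + 2 * h) with (y + h + h) in * by ring.
  rewrite (im_contour_split_x f x (x + w)); try lra;
    try (intros; repeat split; apply Hf; lra).
  rewrite (im_contour_split_y f x (x + w) y (y + h)); try lra;
    try (intros; repeat split; apply Hf; lra).
  rewrite (im_contour_split_y f (x + w) (x + w + w) y (y + h)); try lra;
    try (intros; repeat split; apply Hf; lra).
Qed.

Lemma half_step (a : R) (n : nat) : a / 2 ^ n = 2 * (a / 2 ^ S n).
Proof. assert (2 ^ n <> 0) by (apply pow_nonzero; lra). simpl. field. assumption. Qed.

Lemma side_ge_0 (a : R) (n : nat) : 0 <= a -> 0 <= a / 2 ^ n.
Proof.
  intros Ha. apply Rmult_le_pos; [exact Ha|].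
  left; apply Rinv_0_lt_compat, pow_lt; lra.
Qed.

(** The supremum of the left ends is at most every right end. *)
Lemma nested_point (u : nat -> R) (a : R) :
  (forall n k : nat, u n <= u (n + k)%nat /\ u (n + k)%nat + a / 2 ^ (n + k) <= u n + a / 2 ^ n) ->
  0 <= a -> exists t, forall n, u n <= t <= u n + a / 2 ^ n.
Proof.
  intros Hu Ha.
  assert (Hub : forall m n, u m <= u n + a / 2 ^ n).
  { intros m n. destruct (Nat.le_gt_cases n m) as [Hnm|Hnm].
    - replace m with (n + (m - n))%nat by lia.
      pose proof (Hu n (m - n)%nat). pose proof (side_ge_0 a (n + (m - n)) Ha). lra.
    - pose proof (Hu m (n - m)%nat) as H. replace (m + (n - m))%nat with n in H by lia.
      pose proof (side_ge_0 a n Ha). lra. }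
  destruct (completeness (fun t => exists n, t = u n)) as [t [Ht1 Ht2]].
  - exists (u O + a / 2 ^ 0). intros t [n ->]. apply Hub.
  - exists (u O), O. reflexivity.
  - exists t. intros n. split.
    + apply Ht1. exists n; reflexivity.
    + apply Ht2. intros t' [m ->]. apply Hub.
Qed.

Section Bisection.

Variables (f : C -> C) (eps : R).

(** The bound is proportional to the square of the size, so that if it fails for a
    rectangle it fails for one of its quarters. *)
Definition oversized (x y w h : R) : Prop :=
  eps * (w + h) ^ 2 < Rabs (im_contour f x (x + w) y (y + h)).

Definition oversized_dec (x y w h : R) : {oversized x y w h} + {~ oversized x y w h} :=
  Rlt_dec _ _.

Definition bisect (p : R * R) (w h : R) : R * R :=
  let (x, y) := p in
  if oversized_dec x y w h then (x, y)
  else if oversized_dec (x + w) y w h then (x + w, y)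
  else if oversized_dec x (y + h) w h then (x, y + h)
  else (x + w, y + h).

Lemma bisect_bounds (p : R * R) (w h : R) : 0 <= w -> 0 <= h ->
  fst p <= fst (bisect p w h) <= fst p + w /\ snd p <= snd (bisect p w h) <= snd p + h.
Proof.
  intros Hw Hh. destruct p as [x y]; unfold bisect.
  repeat destruct oversized_dec; simpl; lra.
Qed.

Lemma bisect_oversized (p : R * R) (w h : R) : 0 <= w -> 0 <= h ->
  holomorphic_on_rect f (fst p) (fst p + 2 * w) (snd p) (snd p + 2 * h) ->
  oversized (fst p) (snd p) (2 * w) (2 * h) ->
  oversized (fst (bisect p w h)) (snd (bisect p w h)) w h.
Proof.
  intros Hw Hh Hf Hb. destruct p as [x y]; unfold bisect; simpl in *.
  destruct (oversized_dec x y w h) as [?|N1]; [assumption|].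
  destruct (oversized_dec (x + w) y w h) as [?|N2]; [assumption|].
  destruct (oversized_dec x (y + h) w h) as [?|N3]; [assumption|].
  unfold oversized in *. simpl fst; simpl snd.
  rewrite im_contour_quarters in Hb by assumption.
  apply Rnot_lt_le in N1. apply Rnot_lt_le in N2. apply Rnot_lt_le in N3.
  apply Rabs_le_between in N1. apply Rabs_le_between in N2. apply Rabs_le_between in N3.
  apply Rnot_le_lt. intros N4. apply Rabs_le_between in N4.
  revert Hb. apply Rle_not_lt, Rabs_le. lra.
Qed.

Variables (x0 y0 w h : R).
Hypotheses (Hw : 0 <= w) (Hh : 0 <= h).
Hypothesis Hf : holomorphic_on_rect f x0 (x0 + w) y0 (y0 + h).
Hypothesis Hover : oversized x0 y0 w h.

(** Only the lower left corner is recorded: after n bisections the sides are w / 2^n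
    and h / 2^n. *)
Fixpoint corner (n : nat) : R * R :=
  match n with
  | O => (x0, y0)
  | S m => bisect (corner m) (w / 2 ^ S m) (h / 2 ^ S m)
  end.

Lemma corner_step (n : nat) :
  fst (corner n) <= fst (corner (S n)) /\
  fst (corner (S n)) + w / 2 ^ S n <= fst (corner n) + w / 2 ^ n /\
  snd (corner n) <= snd (corner (S n)) /\
  snd (corner (S n)) + h / 2 ^ S n <= snd (corner n) + h / 2 ^ n.
Proof.
  destruct (bisect_bounds (corner n) (w / 2 ^ S n) (h / 2 ^ S n)) as [Bx By];
    try (apply side_ge_0; assumption).
  rewrite !(half_step _ n). cbn [corner]. lra.
Qed.

Lemma corner_nested (n k : nat) :
  fst (corner n) <= fst (corner (n + k)) /\
  fst (corner (n + k)) + w / 2 ^ (n + k) <= fst (corner n) + w / 2 ^ n /\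
  snd (corner n) <= snd (corner (n + k)) /\
  snd (corner (n + k)) + h / 2 ^ (n + k) <= snd (corner n) + h / 2 ^ n.
Proof.
  induction k as [|k IH].
  - rewrite Nat.add_0_r. lra.
  - rewrite Nat.add_succ_r. pose proof (corner_step (n + k)). lra.
Qed.

Lemma corner_holomorphic (n : nat) :
  holomorphic_on_rect f (fst (corner n)) (fst (corner n) + w / 2 ^ n)
    (snd (corner n)) (snd (corner n) + h / 2 ^ n).
Proof.
  intros x y Hx Hy. pose proof (corner_nested 0 n) as H. rewrite Nat.add_0_l in H.
  simpl in H. apply Hf; lra.
Qed.

Lemma corner_oversized (n : nat) :
  oversized (fst (corner n)) (snd (corner n)) (w / 2 ^ n) (h / 2 ^ n).
Proof.
  induction n as [|n IH].
  - cbn [corner fst snd]. replace (w / 2 ^ 0) with w by (simpl; field).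
    replace (h / 2 ^ 0) with h by (simpl; field). exact Hover.
  - pose proof (corner_holomorphic n) as Hn. cbn [corner].
    rewrite (half_step w), (half_step h) in IH.
    rewrite (half_step w), (half_step h) in Hn.
    apply bisect_oversized; try (apply side_ge_0; assumption); assumption.
Qed.

(** At the common point of the bisected rectangles f is differentiable, so small
    rectangles around it obey the bound ([im_contour_small]). *)
Lemma no_oversized_rect : 0 < eps -> False.
Proof.
  intros Heps.
  destruct (nested_point (fun n => fst (corner n)) w) as [a Ha];
    [intros n k; pose proof (corner_nested n k); lra | assumption |].
  destruct (nested_point (fun n => snd (corner n)) h) as [b Hb];
    [intros n k; pose proof (corner_nested n k); lra | assumption |].
  destruct (im_contour_small f a b eps) as [d [Hd0 Hd]]; [| assumption |].
  - specialize (Ha O). specialize (Hb O). simpl in Ha, Hb. apply Hf; lra.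
  - destruct (pow_lt_1_zero (/ 2)) with (y := d / (w + h + 1)) as [N HN].
    + rewrite Rabs_pos_eq; lra.
    + apply Rdiv_lt_0_compat; lra.
    + specialize (HN N (le_n N)).
      assert (Hp : 0 < (/ 2) ^ N) by (apply pow_lt; lra).
      rewrite Rabs_pos_eq in HN by lra.
      apply Rmult_lt_compat_r with (r := w + h + 1) in HN; [|lra].
      replace (d / (w + h + 1) * (w + h + 1)) with d in HN by (field; lra).
      rewrite pow_inv in Hp, HN.
      pose proof (corner_oversized N) as Ho. unfold oversized in Ho.
      apply (Rlt_not_le _ _ Ho), Hd; [apply Ha | apply Hb | | apply corner_holomorphic].
      unfold Rdiv. nra.
Qed.

End Bisection.

(** Green's formula would need a continuous derivative, which for zeta could only come
    out of Cauchy's theory.  The bisection uses the derivative at one point only. *)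
Theorem goursat (f : C -> C) (x0 x1 y0 y1 : R) :
  x0 <= x1 -> y0 <= y1 -> holomorphic_on_rect f x0 x1 y0 y1 ->
  im_contour f x0 x1 y0 y1 = 0.
Proof.
  intros Hx Hy Hf. apply Rabs_eq_0, Rle_antisym; [| apply Rabs_pos].
  apply Rnot_lt_le. intros Hpos.
  replace x1 with (x0 + (x1 - x0)) in Hf, Hpos by ring.
  replace y1 with (y0 + (y1 - y0)) in Hf, Hpos by ring.
  set (w := x1 - x0) in *. set (h := y1 - y0) in *.
  set (J := Rabs _) in Hpos.
  (* with this constant the bound is less than J as soon as J is positive *)
  apply (no_oversized_rect f (J / (2 * ((w + h) ^ 2 + 1))) x0 y0 w h).
  - unfold w; lra.
  - unfold h; lra.
  - exact Hf.
  - unfold oversized. fold J.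
    pose proof (pow2_ge_0 (w + h)).
    apply Rmult_lt_reg_r with (2 * ((w + h) ^ 2 + 1)); [lra|].
    replace (J / (2 * ((w + h) ^ 2 + 1)) * (w + h) ^ 2 * (2 * ((w + h) ^ 2 + 1)))
      with (J * (w + h) ^ 2) by (field; nra). nra.
  - pose proof (pow2_ge_0 (w + h)). apply Rdiv_lt_0_compat; lra.
Qed.

(** * A Cauchy estimate on squares *)

(** The ring between the two squares is cut into four rectangles which avoid the
    centre, and Goursat's theorem applies to each of them. *)
Lemma im_contour_shrink (f : C -> C) (a b r r' : R) :
  0 < r' <= r ->
  (forall x y, Rabs (x - a) <= r -> Rabs (y - b) <= r -> (x, y) <> (a, b) ->
    holomorphic_at f (x, y)) ->
  im_contour f (a - r) (a + r) (b - r) (b + r) =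
  im_contour f (a - r') (a + r') (b - r') (b + r').
Proof.
  intros Hr Hf0.
  assert (Hf : forall x y, a - r <= x <= a + r -> b - r <= y <= b + r -> x <> a \/ y <> b ->
    holomorphic_at f (x, y)).
  { intros x y Hx Hy Hn. apply Hf0; [apply Rabs_le; lra | apply Rabs_le; lra |].
    intros E; injection E; intros; destruct Hn; contradiction. }
  assert (Hf' : forall x y, a - r <= x <= a + r -> b - r <= y <= b + r ->
     (x < a \/ a < x) \/ (y < b \/ b < y) -> holomorphic_at f (x, y)).
  { intros x y Hx Hy Hn. apply Hf; [assumption | assumption | lra]. }
  rewrite (im_contour_split_x f _ (a - r')); try lra;
    try (intros; repeat split; apply Hf'; lra).
  rewrite (im_contour_split_x f (a - r') (a + r')); try lra;
    try (intros; repeat split; apply Hf'; lra).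
  rewrite (im_contour_split_y f (a - r') (a + r') (b - r) (b - r')); try lra;
    try (intros; repeat split; apply Hf'; lra).
  rewrite (im_contour_split_y f (a - r') (a + r') (b - r') (b + r')); try lra;
    try (intros; repeat split; apply Hf'; lra).
  rewrite (goursat f (a - r) (a - r')); try lra; try (intros x y Hx Hy; apply Hf'; lra).
  rewrite (goursat f (a + r') (a + r)); try lra; try (intros x y Hx Hy; apply Hf'; lra).
  rewrite (goursat f (a - r') (a + r') (b - r) (b - r')); try lra;
    try (intros x y Hx Hy; apply Hf'; lra).
  rewrite (goursat f (a - r') (a + r') (b + r') (b + r)); try lra;
    try (intros x y Hx Hy; apply Hf'; lra).
Qed.

Definition on_square_boundary (a b r x y : R) : Prop :=
  (Rabs (x - a) = r /\ Rabs (y - b) <= r) \/ (Rabs (x - a) <= r /\ Rabs (y - b) = r).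

Lemma sides_on_square_boundary (a b r t : R) : 0 <= r ->
  (a - r <= t <= a + r ->
    on_square_boundary a b r t (b - r) /\ on_square_boundary a b r t (b + r)) /\
  (b - r <= t <= b + r ->
    on_square_boundary a b r (a - r) t /\ on_square_boundary a b r (a + r) t).
Proof.
  intros Hr.
  assert (H : forall u, Rabs (u - r - u) = r /\ Rabs (u + r - u) = r).
  { intros u. replace (u - r - u) with (- r) by ring. replace (u + r - u) with r by ring.
    rewrite Rabs_Ropp, Rabs_pos_eq by exact Hr. split; reflexivity. }
  destruct (H a), (H b).
  split; intros Ht; split; [right | right | left | left];
    split; assumption || (apply Rabs_le; lra).
Qed.

Lemma im_contour_bound (f : C -> C) (a b r M : R) :
  0 <= r ->
  (forall x y, on_square_boundary a b r x y -> holomorphic_at f (x, y) /\ Cmod (f (x, y)) <= M) ->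
  Rabs (im_contour f (a - r) (a + r) (b - r) (b + r)) <= 8 * r * M.
Proof.
  intros Hr Hf.
  assert (Hh := fun x => proj1 (sides_on_square_boundary a b r x Hr)).
  assert (Hv := fun y => proj2 (sides_on_square_boundary a b r y Hr)).
  unfold im_contour.
  assert (B1 : - (2 * M) * (a + r - (a - r)) <=
     RInt (fun x => Im (f (x, b - r)) - Im (f (x, b + r))) (a - r) (a + r) <=
     2 * M * (a + r - (a - r))).
  { apply RInt_between; [lra | apply ex_RInt_horizontal; [lra |] |].
    - intros x Hx. destruct (Hh x Hx). split; apply Hf; assumption.
    - intros x Hx. destruct (Hh x Hx) as [H1 H2].
      destruct (Hf _ _ H1) as [_ M1]. destruct (Hf _ _ H2) as [_ M2].
      pose proof (Rle_trans _ _ _ (im_le_Cmod _) M1) as N1.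
      pose proof (Rle_trans _ _ _ (im_le_Cmod _) M2) as N2.
      apply Rabs_le_between in N1. apply Rabs_le_between in N2. lra. }
  assert (B2 : - (2 * M) * (b + r - (b - r)) <=
     RInt (fun y => Re (f (a + r, y)) - Re (f (a - r, y))) (b - r) (b + r) <=
     2 * M * (b + r - (b - r))).
  { apply RInt_between; [lra | apply ex_RInt_vertical; [lra |] |].
    - intros x Hx. destruct (Hv x Hx). split; apply Hf; assumption.
    - intros x Hx. destruct (Hv x Hx) as [H1 H2].
      destruct (Hf _ _ H1) as [_ M1]. destruct (Hf _ _ H2) as [_ M2].
      pose proof (Rle_trans _ _ _ (re_le_Cmod _) M1) as N1.
      pose proof (Rle_trans _ _ _ (re_le_Cmod _) M2) as N2.
      apply Rabs_le_between in N1. apply Rabs_le_between in N2. lra. }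
  apply Rabs_le. lra.
Qed.

(** The exact value is 2 pi; the lower bound 4 comes from the integrand
    2r / (u^2 + r^2) being at least 1/r on both pairs of sides. *)
Lemma im_contour_inv (a b r : R) : 0 < r ->
  4 <= im_contour (fun z => / (z - (a, b)))%C (a - r) (a + r) (b - r) (b + r).
Proof.
  intros Hr. set (f := fun z => (/ (z - (a, b)))%C).
  assert (Hhol : forall x y, x - a <> 0 \/ y - b <> 0 -> holomorphic_at f (x, y)).
  { intros x y Hn. apply (holomorphic_at_comp Cinv (fun z => z - (a, b))%C).
    - apply holomorphic_at_inv. unfold Cminus, Cplus, Copp; simpl. intros E.
      injection E; intros; destruct Hn; lra.
    - apply holomorphic_at_minus; [apply holomorphic_at_id | apply holomorphic_at_const]. }
  assert (Hb : forall u, - r <= u <= r -> / r <= 2 * r / (u ^ 2 + r ^ 2) <= 2 / r).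
  { intros u Hu. assert (0 <= u ^ 2 <= r ^ 2) by (split; [apply pow2_ge_0 | nra]).
    assert (0 < r ^ 2) by nra.
    split; apply Rmult_le_reg_r with (r * (u ^ 2 + r ^ 2)); try nra.
    - replace (/ r * (r * (u ^ 2 + r ^ 2))) with (u ^ 2 + r ^ 2) by (field; lra).
      replace (2 * r / (u ^ 2 + r ^ 2) * (r * (u ^ 2 + r ^ 2))) with (2 * r ^ 2) by (field; nra).
      lra.
    - replace (2 / r * (r * (u ^ 2 + r ^ 2))) with (2 * (u ^ 2 + r ^ 2)) by (field; lra).
      replace (2 * r / (u ^ 2 + r ^ 2) * (r * (u ^ 2 + r ^ 2))) with (2 * r ^ 2) by (field; nra).
      lra. }
  assert (Eh : forall x, Im (f (x, b - r)) - Im (f (x, b + r)) = 2 * r / ((x - a) ^ 2 + r ^ 2)).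
  { intros x. assert (0 <= (x - a) ^ 2) by apply pow2_ge_0.
    unfold f, Im, Cinv, Cminus, Cplus, Copp; simpl. field; repeat split; nra. }
  assert (Ev : forall y, Re (f (a + r, y)) - Re (f (a - r, y)) = 2 * r / ((y - b) ^ 2 + r ^ 2)).
  { intros y. assert (0 <= (y - b) ^ 2) by apply pow2_ge_0.
    unfold f, Re, Cinv, Cminus, Cplus, Copp; simpl. field; repeat split; nra. }
  unfold im_contour.
  assert (B1 : / r * (a + r - (a - r)) <=
     RInt (fun x => Im (f (x, b - r)) - Im (f (x, b + r))) (a - r) (a + r) <=
     2 / r * (a + r - (a - r))).
  { apply RInt_between; [lra | apply ex_RInt_horizontal; [lra |] |].
    - intros x Hx. split; apply Hhol; right; lra.
    - intros x Hx. rewrite Eh. apply Hb; lra. }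
  assert (B2 : / r * (b + r - (b - r)) <=
     RInt (fun y => Re (f (a + r, y)) - Re (f (a - r, y))) (b - r) (b + r) <=
     2 / r * (b + r - (b - r))).
  { apply RInt_between; [lra | apply ex_RInt_vertical; [lra |] |].
    - intros x Hx. split; apply Hhol; left; lra.
    - intros x Hx. rewrite Ev. apply Hb; lra. }
  replace (/ r * (a + r - (a - r))) with 2 in B1 by (field; lra).
  replace (/ r * (b + r - (b - r))) with 2 in B2 by (field; lra).
  lra.
Qed.

Lemma im_contour_minus (f g : C -> C) (x0 x1 y0 y1 : R) :
  x0 <= x1 -> y0 <= y1 ->
  (forall x, x0 <= x <= x1 -> (holomorphic_at f (x, y0) /\ holomorphic_at f (x, y1)) /\
     holomorphic_at g (x, y0) /\ holomorphic_at g (x, y1)) ->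
  (forall y, y0 <= y <= y1 -> (holomorphic_at f (x0, y) /\ holomorphic_at f (x1, y)) /\
     holomorphic_at g (x0, y) /\ holomorphic_at g (x1, y)) ->
  im_contour (fun z => f z - g z)%C x0 x1 y0 y1 =
  im_contour f x0 x1 y0 y1 - im_contour g x0 x1 y0 y1.
Proof.
  intros Hx Hy Hh Hv. unfold im_contour.
  assert (E1 : RInt (fun x => Im (f (x, y0) - g (x, y0))%C - Im (f (x, y1) - g (x, y1))%C) x0 x1
    = RInt (fun x => Im (f (x, y0)) - Im (f (x, y1))) x0 x1 -
      RInt (fun x => Im (g (x, y0)) - Im (g (x, y1))) x0 x1).
  { symmetry. etransitivity.
    - symmetry. apply (RInt_minus (V := R_CompleteNormedModule));
        (apply ex_RInt_horizontal; [assumption | intros x Hxx; apply Hh; assumption]).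
    - apply RInt_ext. intros x _. unfold minus, plus, opp, Im; simpl. ring. }
  assert (E2 : RInt (fun y => Re (f (x1, y) - g (x1, y))%C - Re (f (x0, y) - g (x0, y))%C) y0 y1
    = RInt (fun y => Re (f (x1, y)) - Re (f (x0, y))) y0 y1 -
      RInt (fun y => Re (g (x1, y)) - Re (g (x0, y))) y0 y1).
  { symmetry. etransitivity.
    - symmetry. apply (RInt_minus (V := R_CompleteNormedModule));
        (apply ex_RInt_vertical; [assumption | intros x Hxx; apply Hv; assumption]).
    - apply RInt_ext. intros x _. unfold minus, plus, opp, Re; simpl. ring. }
  rewrite E1, E2. ring.
Qed.

Lemma on_square_boundary_dist (a b r x y : R) : 0 < r ->
  on_square_boundary a b r x y ->
  r <= Cmod ((x, y) - (a, b))%C <= 2 * r.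
Proof.
  intros Hr Hb.
  replace ((x, y) - (a, b))%C with ((x - a, y - b) : C)
    by (unfold Cminus, Cplus, Copp; simpl; reflexivity).
  split.
  - pose proof (re_le_Cmod (x - a, y - b)). pose proof (im_le_Cmod (x - a, y - b)).
    unfold Re, Im in *; simpl in *. destruct Hb; lra.
  - eapply Rle_trans; [apply Cmod_le_Rabs|]. destruct Hb; lra.
Qed.

Lemma in_square_of_boundary (a b r x y : R) :
  on_square_boundary a b r x y -> Rabs (x - a) <= r /\ Rabs (y - b) <= r.
Proof. intros [H|H]; lra. Qed.

(** A weak maximum principle.  After normalising g to have value 1 at the centre, the
    quotient (g(z) - 1) / (z - z0) is bounded near z0, so its integral over small
    squares tends to 0, and is 0 by [im_contour_shrink].  Hence g(z) / (z - z0) has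
    the same integral as 1 / (z - z0), which [im_contour_inv] bounds from below. *)
Lemma center_bound (g : C -> C) (a b r M : R) :
  0 < r ->
  (forall x y, Rabs (x - a) <= r -> Rabs (y - b) <= r -> holomorphic_at g (x, y)) ->
  (forall x y, on_square_boundary a b r x y -> Cmod (g (x, y)) <= M) ->
  Cmod (g (a, b)) <= 2 * M.
Proof.
  intros Hr Hg HM.
  assert (HM0 : 0 <= M).
  { apply Rle_trans with (Cmod (g (a + r, b))); [apply Cmod_ge_0 | apply HM].
    left. replace (a + r - a) with r by ring. replace (b - b) with 0 by ring.
    rewrite Rabs_R0, Rabs_pos_eq; lra. }
  destruct (Ceq_dec (g (a, b)) 0) as [E0|N0]; [rewrite E0, Cmod_0; lra|].
  set (z0 := (a, b) : C) in *. set (g0 := g z0) in *.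
  assert (Hg0 : 0 < Cmod g0) by (apply Cmod_gt_0; exact N0).
  set (q := fun z => ((g z / g0 - 1) / (z - z0))%C).
  assert (Hk : forall z, z <> z0 -> holomorphic_at (fun z => / (z - z0))%C z).
  { intros z Hz. apply (holomorphic_at_comp Cinv (fun z => z - z0)%C).
    - apply holomorphic_at_inv. apply Cminus_eq_contra, Hz.
    - apply holomorphic_at_minus; [apply holomorphic_at_id | apply holomorphic_at_const]. }
  assert (Hn : forall z, holomorphic_at g z -> holomorphic_at (fun z => g z / g0)%C z).
  { intros z Hz. apply holomorphic_at_div; [exact N0 | exact Hz | apply holomorphic_at_const]. }
  assert (Hq : forall x y, Rabs (x - a) <= r -> Rabs (y - b) <= r -> (x, y) <> (a, b) ->
    holomorphic_at q (x, y)).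
  { intros x y Hx Hy Hxy. unfold q, Cdiv at 1. apply holomorphic_at_mult; [|apply Hk, Hxy].
    apply holomorphic_at_minus; [apply Hn, Hg; assumption | apply holomorphic_at_const]. }
  assert (Hoff : forall s x y, 0 < s -> on_square_boundary a b s x y -> (x, y) <> (a, b)).
  { intros s x y Hs Hb E. injection E; intros -> ->.
    pose proof (on_square_boundary_dist a b s a b Hs Hb) as [H1 _].
    replace ((a, b) - (a, b))%C with (RtoC 0) in H1
      by (unfold RtoC, Cminus, Cplus, Copp; simpl; f_equal; ring).
    rewrite Cmod_0 in H1. lra. }
  assert (Hq0 : im_contour q (a - r) (a + r) (b - r) (b + r) = 0).
  { set (J := im_contour _ _ _ _ _).
    destruct (Hg a b) as [l Hl]; [replace (a - a) with 0 by ring; rewrite Rabs_R0; lra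
      | replace (b - b) with 0 by ring; rewrite Rabs_R0; lra |].
    destruct (proj1 (is_derive_C g z0 l) Hl 1 Rlt_0_1) as [d [Hd0 Hd]].
    (* K bounds the quotient q near the centre *)
    set (K := (Cmod l + 1) / Cmod g0).
    assert (HK : 0 < K) by (apply Rdiv_lt_0_compat; [pose proof (Cmod_ge_0 l); lra | assumption]).
    assert (Hs : forall s, 0 < s <= r -> s < d / 2 -> Rabs J <= 8 * s * K).
    { intros s Hs Hsd. unfold J. rewrite (im_contour_shrink q a b r s Hs Hq).
      apply im_contour_bound; [lra|]. intros x y Hb.
      pose proof (in_square_of_boundary _ _ _ _ _ Hb) as [Hx Hy].
      pose proof (on_square_boundary_dist _ _ _ _ _ (proj1 Hs) Hb) as [D1 D2].
      pose proof (Hoff s x y (proj1 Hs) Hb) as Hne.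
      fold z0 in D1, D2, Hne. set (z := (x, y) : C) in *.
      assert (Hz : (z - z0)%C <> 0) by (apply Cminus_eq_contra, Hne).
      split; [apply Hq; solve [lra | exact Hne]|].
      assert (Hl1 : Cmod (g z - g0) <= (Cmod l + 1) * Cmod (z - z0)).
      { replace (g z - g0)%C with ((g z - g z0 - l * (z - z0)) + l * (z - z0))%C
          by (unfold g0; ring).
        eapply Rle_trans; [apply Cmod_triangle|]. rewrite Cmod_mult.
        assert (Hzd : Cmod (z - z0) < d) by lra. specialize (Hd z Hzd). lra. }
      unfold q. replace ((g z / g0 - 1) / (z - z0))%C with ((g z - g0) / (g0 * (z - z0)))%C
        by (field; auto).
      rewrite Cmod_div by (apply Cmult_neq_0; assumption). rewrite Cmod_mult.
      unfold K. assert (0 < Cmod (z - z0)) by lra.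
      apply Rmult_le_reg_r with (Cmod g0 * Cmod (z - z0)); [apply Rmult_lt_0_compat; lra|].
      replace (Cmod (g z - g0) / (Cmod g0 * Cmod (z - z0)) * (Cmod g0 * Cmod (z - z0)))
        with (Cmod (g z - g0)) by (field; lra).
      replace ((Cmod l + 1) / Cmod g0 * (Cmod g0 * Cmod (z - z0)))
        with ((Cmod l + 1) * Cmod (z - z0)) by (field; lra).
      exact Hl1. }
    apply Rabs_eq_0, Rle_antisym; [| apply Rabs_pos].
    apply Rnot_lt_le; intros HJ.
    set (s := Rmin r (Rmin (d / 3) (Rabs J / (16 * K)))).
    assert (S1 : s <= r) by apply Rmin_l.
    assert (S2 : s <= d / 3) by (eapply Rle_trans; [apply Rmin_r | apply Rmin_l]).
    assert (S3 : s <= Rabs J / (16 * K)) by (eapply Rle_trans; [apply Rmin_r | apply Rmin_r]).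
    assert (S0 : 0 < s) by (repeat apply Rmin_glb_lt; try lra; apply Rdiv_lt_0_compat; lra).
    specialize (Hs s (conj S0 S1)).
    apply Rmult_le_compat_r with (r := 16 * K) in S3; [|lra].
    replace (Rabs J / (16 * K) * (16 * K)) with (Rabs J) in S3 by (field; lra).
    lra. }
  assert (Hb : forall x y, on_square_boundary a b r x y ->
     holomorphic_at (fun z => g z / g0 * / (z - z0))%C (x, y) /\
     holomorphic_at (fun z => / (z - z0))%C (x, y)).
  { intros x y Hb. pose proof (in_square_of_boundary _ _ _ _ _ Hb) as [Hx Hy].
    pose proof (Hoff r x y Hr Hb) as Hne.
    split; [apply holomorphic_at_mult; [apply Hn, Hg; assumption|]|]; apply Hk, Hne. }
  assert (Hh := fun x => proj1 (sides_on_square_boundary a b r x (Rlt_le _ _ Hr))).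
  assert (Hv := fun y => proj2 (sides_on_square_boundary a b r y (Rlt_le _ _ Hr))).
  assert (Hsplit : im_contour q (a - r) (a + r) (b - r) (b + r) =
     im_contour (fun z => g z / g0 * / (z - z0))%C (a - r) (a + r) (b - r) (b + r) -
     im_contour (fun z => / (z - z0))%C (a - r) (a + r) (b - r) (b + r)).
  { rewrite <- im_contour_minus; try lra.
    - unfold im_contour. f_equal; apply RInt_ext; intros t _; unfold q, Cdiv;
      f_equal; f_equal; ring.
    - intros x Hx. destruct (Hh x Hx) as [H1 H2]. apply Hb in H1. apply Hb in H2. tauto.
    - intros y Hy. destruct (Hv y Hy) as [H1 H2]. apply Hb in H1. apply Hb in H2. tauto. }
  pose proof (im_contour_inv a b r Hr) as H4. fold z0 in H4.
  assert (H8 : Rabs (im_contour (fun z => g z / g0 * / (z - z0))%C (a - r) (a + r) (b - r) (b + r))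
     <= 8 * r * (M / Cmod g0 * / r)).
  { apply im_contour_bound; [lra|]. intros x y Hxy. split; [apply Hb, Hxy|].
    pose proof (on_square_boundary_dist _ _ _ _ _ Hr Hxy) as [D1 _]. fold z0 in D1.
    rewrite Cmod_mult, Cmod_div by exact N0.
    rewrite Cmod_inv by (apply Cminus_eq_contra, (Hoff r x y Hr Hxy)).
    apply Rmult_le_compat.
    - apply Rmult_le_pos; [apply Cmod_ge_0 | left; apply Rinv_0_lt_compat, Hg0].
    - left; apply Rinv_0_lt_compat. lra.
    - apply Rmult_le_compat_r; [left; apply Rinv_0_lt_compat, Hg0 | apply HM, Hxy].
    - apply Rinv_le_contravar; lra. }
  replace (8 * r * (M / Cmod g0 * / r)) with (8 * M / Cmod g0) in H8 by (field; lra).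
  pose proof (Rle_abs (im_contour (fun z => g z / g0 * / (z - z0))%C (a - r) (a + r) (b - r) (b + r))).
  assert (H5 : 4 <= 8 * M / Cmod g0) by lra.
  apply Rmult_le_compat_r with (r := Cmod g0) in H5; [|lra].
  replace (8 * M / Cmod g0 * Cmod g0) with (8 * M) in H5 by (field; lra). lra.
Qed.

(** * The identity theorem on the right half plane *)

Lemma bounded_on_horizontal (f : C -> C) (y a b : R) :
  (forall x, a <= x <= b -> holomorphic_at f (x, y)) ->
  exists M, forall x, a <= x <= b -> Cmod (f (x, y)) <= M.
Proof.
  intros Hf.
  destruct (bounded_continuity (V := R_NormedModule) (fun x => Re (f (x, y))) a b) as [M1 H1].
  { intros x Hx. apply holomorphic_at_horizontal, Hf, Hx. }
  destruct (bounded_continuity (V := R_NormedModule) (fun x => Im (f (x, y))) a b) as [M2 H2].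
  { intros x Hx. apply holomorphic_at_horizontal, Hf, Hx. }
  exists (M1 + M2). intros x Hx.
  rewrite (surjective_pairing (f (x, y))). eapply Rle_trans; [apply Cmod_le_Rabs|].
  apply Rplus_le_compat; left; [apply (H1 x Hx) | apply (H2 x Hx)].
Qed.

Lemma bounded_on_vertical (f : C -> C) (x a b : R) :
  (forall y, a <= y <= b -> holomorphic_at f (x, y)) ->
  exists M, forall y, a <= y <= b -> Cmod (f (x, y)) <= M.
Proof.
  intros Hf.
  destruct (bounded_continuity (V := R_NormedModule) (fun y => Re (f (x, y))) a b) as [M1 H1].
  { intros y Hy. apply holomorphic_at_vertical, Hf, Hy. }
  destruct (bounded_continuity (V := R_NormedModule) (fun y => Im (f (x, y))) a b) as [M2 H2].
  { intros y Hy. apply holomorphic_at_vertical, Hf, Hy. }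
  exists (M1 + M2). intros y Hy.
  rewrite (surjective_pairing (f (x, y))). eapply Rle_trans; [apply Cmod_le_Rabs|].
  apply Rplus_le_compat; left; [apply (H1 y Hy) | apply (H2 y Hy)].
Qed.

Lemma bounded_on_square_boundary (f : C -> C) (a b r : R) :
  (forall x y, Rabs (x - a) <= r -> Rabs (y - b) <= r -> holomorphic_at f (x, y)) ->
  exists M, forall x y, on_square_boundary a b r x y -> Cmod (f (x, y)) <= M.
Proof.
  intros Hf. destruct (Rle_lt_dec 0 r) as [Hr|Hr].
  2: { exists 0. intros x y Hb. pose proof (Rabs_pos (x - a)).
       destruct (in_square_of_boundary _ _ _ _ _ Hb). lra. }
  destruct (bounded_on_horizontal f (b - r) (a - r) (a + r)) as [M1 H1].
  { intros x Hx. apply Hf; apply Rabs_le; lra. }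
  destruct (bounded_on_horizontal f (b + r) (a - r) (a + r)) as [M2 H2].
  { intros x Hx. apply Hf; apply Rabs_le; lra. }
  destruct (bounded_on_vertical f (a - r) (b - r) (b + r)) as [M3 H3].
  { intros x Hx. apply Hf; apply Rabs_le; lra. }
  destruct (bounded_on_vertical f (a + r) (b - r) (b + r)) as [M4 H4].
  { intros x Hx. apply Hf; apply Rabs_le; lra. }
  exists (Rmax (Rmax M1 M2) (Rmax M3 M4)). intros x y [[Hx Hy]|[Hx Hy]].
  - apply Rabs_le_between in Hy. eapply Rle_trans; [| apply Rmax_r].
    destruct (Rcase_abs (x - a)) as [C|C].
    + rewrite Rabs_left in Hx by assumption. replace x with (a - r) by lra.
      eapply Rle_trans; [apply H3; lra | apply Rmax_l].
    + rewrite Rabs_right in Hx by assumption. replace x with (a + r) by lra.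
      eapply Rle_trans; [apply H4; lra | apply Rmax_r].
  - apply Rabs_le_between in Hx. eapply Rle_trans; [| apply Rmax_l].
    destruct (Rcase_abs (y - b)) as [C|C].
    + rewrite Rabs_left in Hy by assumption. replace y with (b - r) by lra.
      eapply Rle_trans; [apply H1; lra | apply Rmax_l].
    + rewrite Rabs_right in Hy by assumption. replace y with (b + r) by lra.
      eapply Rle_trans; [apply H2; lra | apply Rmax_r].
Qed.

Lemma le_geometric_eq_0 (t M : R) : 0 <= t -> (forall n, t <= M * (/ 2) ^ n) -> t = 0.
Proof.
  intros Ht H. apply Rle_antisym; [|exact Ht].
  apply (is_lim_seq_le (fun _ => t) (fun n => M * (/ 2) ^ n) t 0 H).
  - apply is_lim_seq_const.
  - replace (Finite 0) with (Rbar_mult M 0) by (simpl; f_equal; ring).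
    apply is_lim_seq_scal_l, is_lim_seq_geom. rewrite Rabs_pos_eq; lra.
Qed.

(** The point p lies x/4 to the right of z = x + iy, inside the zero region, while the
    square of half side 3x/4 around z stays in the right half plane and at distance
    at least x/2 from p.  Since H vanishes near p, H(w) / (w - p)^n is holomorphic on
    the square, and [center_bound] gives |H(z)| <= 2 M (1/2)^n for every n. *)
Lemma vanishing_step (H : C -> C) (sigma : R) :
  0 < sigma -> (forall z, 0 < Re z -> holomorphic_at H z) ->
  (forall z, sigma < Re z -> H z = 0) ->
  forall z, 4 / 5 * sigma < Re z -> H z = 0.
Proof.
  intros Hs Hhol Hzero [x y] Hx. unfold Re in Hx; simpl in Hx.
  set (p := (x + x / 4, y) : C).
  destruct (bounded_on_square_boundary H x y (3 * x / 4)) as [M HM].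
  { intros u v Hu Hv. apply Hhol. unfold Re; simpl. apply Rabs_le_between in Hu. lra. }
  apply Cmod_eq_0, (le_geometric_eq_0 _ (2 * M)); [apply Cmod_ge_0|]. intros n.
  set (g := fun z => (H z / (z - p) ^ n)%C).
  assert (Hg : Cmod (g (x, y)) <= 2 * (M / (x / 2) ^ n)).
  { apply (center_bound g x y (3 * x / 4)); [lra | |].
    - intros u v Hu Hv. apply Rabs_le_between in Hu.
      destruct (Ceq_dec (u, v) p) as [Ep|Np].
      + (* near p the numerator is 0, so g is constant there *)
        apply (holomorphic_at_ext_loc (fun _ => 0) _ _ (x + x / 4 - sigma)); [lra | |
          apply holomorphic_at_const].
        rewrite Ep. intros w Hw. unfold g. rewrite Hzero; [unfold Cdiv; ring|].
        pose proof (re_le_Cmod (w - p)) as Hw'. unfold Cminus in Hw' at 1.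
        rewrite re_plus, re_opp in Hw'. change (Re p) with (x + x / 4) in Hw'.
        apply Rabs_le_between in Hw'. lra.
      + apply holomorphic_at_div.
        * apply Cpow_nz, Cminus_eq_contra, Np.
        * apply Hhol. unfold Re; simpl. lra.
        * apply (holomorphic_at_pow (fun z => z - p)%C).
          apply holomorphic_at_minus; [apply holomorphic_at_id | apply holomorphic_at_const].
    - intros u v Hb. pose proof (HM u v Hb) as Hm.
      assert (Hr : 0 < 3 * x / 4) by lra.
      pose proof (on_square_boundary_dist _ _ _ _ _ Hr Hb) as [D _].
      assert (Hd : x / 2 <= Cmod ((u, v) - p)).
      { replace ((u, v) - (x, y))%C with (((u, v) - p) + (p - (x, y)))%C in D by ring.
        assert (Hp : Cmod (p - (x, y))%C = x / 4).
        { replace (p - (x, y))%C with (RtoC (x / 4))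
            by (unfold p, RtoC, Cminus, Cplus, Copp; simpl; f_equal; ring).
          rewrite Cmod_R, Rabs_pos_eq; lra. }
        pose proof (Cmod_triangle ((u, v) - p) (p - (x, y))). lra. }
      unfold g. rewrite Cmod_div, Cmod_pow.
      2: { apply Cpow_nz. intros E. rewrite E, Cmod_0 in Hd. lra. }
      apply Rmult_le_compat.
      + apply Cmod_ge_0.
      + left. apply Rinv_0_lt_compat, pow_lt. lra.
      + exact Hm.
      + apply Rinv_le_contravar; [apply pow_lt; lra | apply pow_incr; lra]. }
  assert (Hp : Cmod ((x, y) - p)%C = x / 4).
  { replace ((x, y) - p)%C with (RtoC (- (x / 4)))
      by (unfold p, RtoC, Cminus, Cplus, Copp; simpl; f_equal; ring).
    rewrite Cmod_R, Rabs_Ropp, Rabs_pos_eq; lra. }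
  unfold g in Hg. rewrite Cmod_div, Cmod_pow, Hp in Hg.
  2: { apply Cpow_nz. intros E. rewrite E, Cmod_0 in Hp. lra. }
  assert (P : 0 < (x / 4) ^ n) by (apply pow_lt; lra).
  apply Rmult_le_compat_r with (r := (x / 4) ^ n) in Hg; [|lra].
  replace (Cmod (H (x, y)) / (x / 4) ^ n * (x / 4) ^ n) with (Cmod (H (x, y))) in Hg
    by (field; lra).
  replace (x / 4) with (x / 2 * / 2) in Hg by field.
  assert (P2 : 0 < (x / 2) ^ n) by (apply pow_lt; lra).
  rewrite Rpow_mult_distr in Hg.
  replace (2 * (M / (x / 2) ^ n) * ((x / 2) ^ n * (/ 2) ^ n)) with (2 * M * (/ 2) ^ n) in Hg
    by (field; lra).
  exact Hg.
Qed.

(** Each use of [vanishing_step] shrinks the abscissa of the zero region by the factor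
    4/5. *)
Theorem half_plane_identity (H : C -> C) :
  (forall z, 0 < Re z -> holomorphic_at H z) ->
  (forall z, 1 < Re z -> H z = 0) ->
  forall z, 0 < Re z -> H z = 0.
Proof.
  intros Hhol H1 z Hz.
  assert (Hn : forall n z, (4 / 5) ^ n < Re z -> H z = 0).
  { induction n as [|n IH].
    - exact H1.
    - simpl. apply vanishing_step; [apply pow_lt; lra | exact Hhol | exact IH]. }
  destruct (pow_lt_1_zero (4 / 5)) with (y := Re z) as [N HN]; [rewrite Rabs_pos_eq; lra | exact Hz |].
  apply (Hn N). specialize (HN N (le_n N)).
  rewrite Rabs_pos_eq in HN; [exact HN | apply pow_le; lra].
Qed.

(** * The complex exponential and paths in the plane *)

Lemma exp_nondecreasing (x y : R) : x <= y -> exp x <= exp y.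
Proof. intros [H| ->]; [left; apply exp_increasing, H | right; reflexivity]. Qed.

Lemma Cexp_plus (z w : C) : Cexp (z + w)%C = (Cexp z * Cexp w)%C.
Proof.
  unfold Cexp. rewrite re_plus, im_plus, exp_plus, cos_plus, sin_plus.
  unfold Cmult; simpl. f_equal; ring.
Qed.

Lemma Cexp_0 : Cexp 0 = 1.
Proof. unfold Cexp; simpl. rewrite exp_0, cos_0, sin_0. unfold RtoC. f_equal; ring. Qed.

Lemma Cmod_Cexp (z : C) : Cmod (Cexp z) = exp (Re z).
Proof.
  unfold Cexp, Cmod; simpl fst; simpl snd.
  replace (_ + _) with ((exp (Re z)) ^ 2 * ((sin (Im z))² + (cos (Im z))²)) by (unfold Rsqr; ring).
  rewrite sin2_cos2, Rmult_1_r. apply sqrt_pow2. left; apply exp_pos.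
Qed.

Lemma Cexp_neq_0 (z : C) : Cexp z <> 0.
Proof. apply Cmod_gt_0. rewrite Cmod_Cexp. apply exp_pos. Qed.

Lemma Cexp_opp (z : C) : Cexp (- z)%C = (/ Cexp z)%C.
Proof.
  assert (H : (Cexp (- z) * Cexp z)%C = 1).
  { rewrite <- Cexp_plus. replace (- z + z)%C with (RtoC 0) by ring. apply Cexp_0. }
  replace (Cexp (- z))%C with ((Cexp (- z) * Cexp z) / Cexp z)%C by (field; apply Cexp_neq_0).
  rewrite H. field. apply Cexp_neq_0.
Qed.

Definition path_derive (psi : R -> C) (t : R) (l : C) : Prop :=
  is_derive (fun u => Re (psi u)) t (Re l) /\ is_derive (fun u => Im (psi u)) t (Im l).

Lemma path_derive_const (z : C) (t : R) : path_derive (fun _ => z) t 0.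
Proof. split; apply (is_derive_const (K := R_AbsRing) (V := R_NormedModule)). Qed.

Lemma path_derive_id (t : R) : path_derive RtoC t 1.
Proof.
  split; [exact (is_derive_id (K := R_AbsRing) t) |
    exact (is_derive_const (K := R_AbsRing) (V := R_NormedModule) 0 t)].
Qed.

Lemma path_derive_minus (f g : R -> C) (t : R) (l m : C) :
  path_derive f t l -> path_derive g t m -> path_derive (fun u => f u - g u)%C t (l - m)%C.
Proof.
  intros [Hf1 Hf2] [Hg1 Hg2].
  split; [ apply (is_derive_ext (fun u => Re (f u) - Re (g u)) _ t)
         | apply (is_derive_ext (fun u => Im (f u) - Im (g u)) _ t) ];
    try (intros u; unfold Re, Im; simpl; ring).
  - apply (is_derive_minus (V := R_NormedModule) _ _ _ _ _ Hf1 Hg1).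
  - apply (is_derive_minus (V := R_NormedModule) _ _ _ _ _ Hf2 Hg2).
Qed.

Lemma path_derive_mult (f g : R -> C) (t : R) (l m : C) :
  path_derive f t l -> path_derive g t m ->
  path_derive (fun u => f u * g u)%C t (l * g t + f t * m)%C.
Proof.
  intros [Hf1 Hf2] [Hg1 Hg2]. split.
  - apply (is_derive_ext (fun u => Re (f u) * Re (g u) - Im (f u) * Im (g u)));
      [intros u; symmetry; apply re_mult |].
    replace (Re (l * g t + f t * m)%C) with
      ((Re l * Re (g t) + Re (f t) * Re m) - (Im l * Im (g t) + Im (f t) * Im m))
      by (rewrite re_plus, !re_mult; ring).
    apply (is_derive_minus (V := R_NormedModule));
      apply (is_derive_mult (K := R_AbsRing)); try assumption; exact Rmult_comm.
  - apply (is_derive_ext (fun u => Re (f u) * Im (g u) + Im (f u) * Re (g u)));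
      [intros u; symmetry; apply im_mult |].
    replace (Im (l * g t + f t * m)%C) with
      ((Re l * Im (g t) + Re (f t) * Im m) + (Im l * Re (g t) + Im (f t) * Re m))
      by (rewrite im_plus, !im_mult; ring).
    apply (is_derive_plus (V := R_NormedModule));
      apply (is_derive_mult (K := R_AbsRing)); try assumption; exact Rmult_comm.
Qed.

Lemma path_derive_line (w : C) (t : R) : path_derive (fun u => u * w)%C t w.
Proof.
  pose proof (path_derive_mult RtoC (fun _ => w) t 1 0 (path_derive_id t)
    (path_derive_const w t)) as H. cbv beta in H.
  replace (1 * w + t * 0)%C with w in H by ring. exact H.
Qed.

Lemma path_derive_Cexp (w : C) (t : R) :
  path_derive (fun u => Cexp (u * w)%C) t (w * Cexp (t * w))%C.
Proof.
  split.
  - apply (is_derive_ext (fun u => exp (u * Re w) * cos (u * Im w))).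
    { intros u. unfold Cexp. rewrite re_scal_l, im_scal_l. reflexivity. }
    rewrite re_mult. unfold Cexp. rewrite re_scal_l, im_scal_l. simpl.
    auto_derive; [exact I | ring].
  - apply (is_derive_ext (fun u => exp (u * Re w) * sin (u * Im w))).
    { intros u. unfold Cexp. rewrite re_scal_l, im_scal_l. reflexivity. }
    rewrite im_mult. unfold Cexp. rewrite re_scal_l, im_scal_l. simpl.
    auto_derive; [exact I | ring].
Qed.

(** The mean value inequality, with the speed bounded by the derivative of a variable
    majorant.  It reduces to a real function by projecting psi on the direction of
    its increment. *)
Lemma path_variation (psi psi' : R -> C) (g g' : R -> R) (a b : R) :
  a <= b ->
  (forall t, a <= t <= b -> path_derive psi t (psi' t)) ->
  (forall t, a <= t <= b -> is_derive g t (g' t)) ->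
  (forall t, a <= t <= b -> Cmod (psi' t) <= g' t) ->
  Cmod (psi b - psi a) <= g b - g a.
Proof.
  intros Hab Hpsi Hg Hle.
  set (D := (psi b - psi a)%C).
  set (p := fun t => Cmod D * g t - (Re D * Re (psi t) + Im D * Im (psi t))).
  set (p' := fun t => Cmod D * g' t - (Re D * Re (psi' t) + Im D * Im (psi' t))).
  assert (Hp : forall t, a <= t <= b -> is_derive p t (p' t)).
  { intros t Ht. destruct (Hpsi t Ht) as [H1 H2]. specialize (Hg t Ht).
    apply (is_derive_minus (V := R_NormedModule)).
    - apply is_derive_scal, Hg.
    - apply (is_derive_plus (V := R_NormedModule)); apply is_derive_scal; assumption. }
  destruct (MVT_gen p a b p') as [c [Hc E]].
  - rewrite Rmin_left, Rmax_right by assumption. intros t Ht. apply Hp; lra.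
  - rewrite Rmin_left, Rmax_right by assumption. intros t Ht.
    apply continuity_pt_filterlim, (ex_derive_continuous (V := R_NormedModule)).
    exists (p' t). apply Hp; lra.
  - rewrite Rmin_left, Rmax_right in Hc by assumption.
    assert (Hp0 : 0 <= p' c).
    { unfold p'. specialize (Hle c Hc).
      assert (Hcs : Re D * Re (psi' c) + Im D * Im (psi' c) <= Cmod D * Cmod (psi' c)).
      { replace (Re D * Re (psi' c) + Im D * Im (psi' c)) with (Re (Cconj D * psi' c))
          by (rewrite re_mult, re_conj, im_conj; ring).
        rewrite <- (Cmod_conj D), <- Cmod_mult.
        eapply Rle_trans; [apply Rle_abs | apply re_le_Cmod]. }
      pose proof (Cmod_ge_0 D). nra. }
    assert (Hpab : 0 <= p b - p a) by (rewrite E; nra).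
    assert (Hd : p b - p a = Cmod D * (g b - g a) - Cmod D ^ 2).
    { rewrite Cmod2_alt. unfold p.
      assert (E1 : Re D = Re (psi b) - Re (psi a)) by reflexivity.
      assert (E2 : Im D = Im (psi b) - Im (psi a)) by reflexivity.
      rewrite E1, E2. ring. }
    rewrite Hd in Hpab.
    destruct (Rle_lt_or_eq_dec 0 (Cmod D) (Cmod_ge_0 D)) as [H0|H0]; [nra|].
    rewrite <- H0.
    (* the increment of psi is 0, and g is nondecreasing because its derivative
       bounds a modulus *)
    destruct (MVT_gen g a b g') as [c' [Hc' E']].
    + rewrite Rmin_left, Rmax_right by assumption. intros t Ht. apply Hg; lra.
    + rewrite Rmin_left, Rmax_right by assumption. intros t Ht.
      apply continuity_pt_filterlim, (ex_derive_continuous (V := R_NormedModule)).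
      exists (g' t). apply Hg; lra.
    + rewrite Rmin_left, Rmax_right in Hc' by assumption. rewrite E'.
      specialize (Hle c' Hc'). pose proof (Cmod_ge_0 (psi' c')). nra.
Qed.

Lemma Cexp_minus_1_bound (w : C) : Cmod (Cexp w - 1) <= Cmod w * exp (Cmod w).
Proof.
  pose proof (path_variation (fun t => Cexp (t * w)) (fun t => w * Cexp (t * w))%C
    (fun t => (Cmod w * exp (Cmod w)) * t) (fun _ => Cmod w * exp (Cmod w)) 0 1) as H.
  cbv beta in H. rewrite Cmult_0_l, Cmult_1_l, Cexp_0 in H.
  replace (Cmod w * exp (Cmod w)) with
    (Cmod w * exp (Cmod w) * 1 - Cmod w * exp (Cmod w) * 0) by ring.
  apply H; [lra | intros t _; apply path_derive_Cexp | intros t _; auto_derive; [exact I | ring] |].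
  intros t Ht. rewrite Cmod_mult, Cmod_Cexp. apply Rmult_le_compat_l; [apply Cmod_ge_0|].
  apply exp_nondecreasing. rewrite re_scal_l.
  pose proof (Rle_trans _ _ _ (Rle_abs (Re w)) (re_le_Cmod w)). pose proof (Cmod_ge_0 w). nra.
Qed.

Lemma Cexp_minus_affine_bound (w : C) : Cmod (Cexp w - 1 - w) <= Cmod w ^ 2 * exp (Cmod w).
Proof.
  pose proof (path_variation (fun t => Cexp (t * w) - t * w)%C
    (fun t => w * Cexp (t * w) - w)%C
    (fun t => (Cmod w ^ 2 * exp (Cmod w)) * t) (fun _ => Cmod w ^ 2 * exp (Cmod w)) 0 1) as H.
  cbv beta in H. rewrite Cmult_0_l, Cmult_1_l, Cexp_0 in H.
  replace (Cmod w ^ 2 * exp (Cmod w)) with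
    (Cmod w ^ 2 * exp (Cmod w) * 1 - Cmod w ^ 2 * exp (Cmod w) * 0) by ring.
  replace (Cexp w - 1 - w)%C with (Cexp w - w - (1 - 0))%C by ring.
  apply H; [lra | | intros t _; auto_derive; [exact I | ring] |].
  - intros t _. apply path_derive_minus; [apply path_derive_Cexp | apply path_derive_line].
  - intros t Ht. replace (w * Cexp (t * w) - w)%C with (w * (Cexp (t * w) - 1))%C by ring.
    rewrite Cmod_mult. replace (Cmod w ^ 2 * exp (Cmod w)) with (Cmod w * (Cmod w * exp (Cmod w))) by ring.
    apply Rmult_le_compat_l; [apply Cmod_ge_0|].
    eapply Rle_trans; [apply Cexp_minus_1_bound|].
    assert (Hm : Cmod (t * w) <= Cmod w).
    { rewrite Cmod_mult, Cmod_R, Rabs_pos_eq by lra. pose proof (Cmod_ge_0 w). nra. }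
    apply Rmult_le_compat; [apply Cmod_ge_0 | left; apply exp_pos | exact Hm | apply exp_nondecreasing, Hm].
Qed.

Lemma is_derive_of_quadratic_bound (f : C -> C) (z l : C) (r K : R) :
  0 < r ->
  (forall w, Cmod (w - z) < r -> Cmod (f w - f z - l * (w - z)) <= K * Cmod (w - z) ^ 2) ->
  @is_derive C_AbsRing C_NormedModule f z l.
Proof.
  intros Hr H. apply (is_derive_C f z l). intros eps Heps.
  exists (Rmin r (eps / (Rabs K + 1))). pose proof (Rabs_pos K). split.
  - apply Rmin_glb_lt; [exact Hr | apply Rdiv_lt_0_compat; lra].
  - intros w Hw.
    assert (H1 : Cmod (w - z) < r) by (eapply Rlt_le_trans; [exact Hw | apply Rmin_l]).
    assert (H2 : Cmod (w - z) < eps / (Rabs K + 1)) by (eapply Rlt_le_trans; [exact Hw | apply Rmin_r]).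
    eapply Rle_trans; [apply H, H1|].
    apply Rmult_lt_compat_r with (r := Rabs K + 1) in H2; [|lra].
    replace (eps / (Rabs K + 1) * (Rabs K + 1)) with eps in H2 by (field; lra).
    pose proof (Rle_abs K). pose proof (Cmod_ge_0 (w - z)).
    replace (K * Cmod (w - z) ^ 2) with (K * Cmod (w - z) * Cmod (w - z)) by ring.
    apply Rmult_le_compat_r; [assumption|]. nra.
Qed.

Lemma holomorphic_at_Cexp (z : C) : holomorphic_at Cexp z.
Proof.
  exists (Cexp z).
  apply (is_derive_of_quadratic_bound Cexp z (Cexp z) 1 (Cmod (Cexp z) * exp 1)); [lra|].
  intros w Hw.
  replace w with (z + (w - z))%C at 1 by ring. rewrite Cexp_plus.
  replace (Cexp z * Cexp (w - z) - Cexp z - Cexp z * (w - z))%C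
    with (Cexp z * (Cexp (w - z) - 1 - (w - z)))%C by ring.
  rewrite Cmod_mult, Rmult_assoc. apply Rmult_le_compat_l; [apply Cmod_ge_0|].
  eapply Rle_trans; [apply Cexp_minus_affine_bound|]. rewrite Rmult_comm.
  apply Rmult_le_compat_r; [apply pow2_ge_0 | apply exp_nondecreasing; lra].
Qed.

(** * Convergence of complex sequences *)

Fixpoint partial_sum (f : nat -> C) (M : nat) : C :=
  match M with
  | O => 0
  | S m => partial_sum f m + f (S m)
  end.

Lemma partial_sum_ext (f g : nat -> C) (M : nat) :
  (forall n, (1 <= n)%nat -> f n = g n) -> partial_sum f M = partial_sum g M.
Proof.
  intros H. induction M as [|M IH]; [reflexivity|]. simpl. rewrite IH, H; [reflexivity | lia].
Qed.

Lemma partial_sum_lin (f g h : nat -> C) (k : C) (M : nat) :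
  partial_sum (fun n => f n - g n - k * h n)%C M =
  (partial_sum f M - partial_sum g M - k * partial_sum h M)%C.
Proof. induction M as [|M IH]; simpl; [ring|]. rewrite IH. ring. Qed.

Definition Cconverges (u : nat -> C) (l : C) : Prop :=
  forall eps, 0 < eps -> exists N, forall n, (N <= n)%nat -> Cmod (u n - l) < eps.

Lemma Cconverges_unique (u : nat -> C) (l m : C) :
  Cconverges u l -> Cconverges u m -> l = m.
Proof.
  intros Hl Hm. apply Ceq_minus, Cmod_eq_0, Rle_antisym; [| apply Cmod_ge_0].
  apply Rnot_lt_le. intros H.
  destruct (Hl (Cmod (l - m) / 2)) as [N1 H1]; [lra|].
  destruct (Hm (Cmod (l - m) / 2)) as [N2 H2]; [lra|].
  specialize (H1 (max N1 N2) (Nat.le_max_l _ _)). specialize (H2 (max N1 N2) (Nat.le_max_r _ _)).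
  set (w := u (max N1 N2)) in *.
  pose proof (Cmod_triangle (w - m) (- (w - l))) as T. rewrite Cmod_opp in T.
  replace (w - m + - (w - l))%C with (l - m)%C in T by ring. lra.
Qed.

Lemma Cconverges_subseq (u : nat -> C) (l : C) (phi : nat -> nat) :
  Cconverges u l -> (forall N, exists M, forall n, (M <= n)%nat -> (N <= phi n)%nat) ->
  Cconverges (fun n => u (phi n)) l.
Proof.
  intros Hu Hphi eps Heps. destruct (Hu eps Heps) as [N HN]. destruct (Hphi N) as [M HM].
  exists M. intros n Hn. apply HN, HM, Hn.
Qed.

Lemma Cconverges_lin (u v : nat -> C) (l m k : C) :
  Cconverges u l -> Cconverges v m -> Cconverges (fun n => u n - k * v n)%C (l - k * m)%C.
Proof.
  intros Hu Hv eps Heps. pose proof (Cmod_ge_0 k).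
  destruct (Hu (eps / 2)) as [N1 H1]; [lra|].
  destruct (Hv (eps / (2 * (Cmod k + 1)))) as [N2 H2]; [apply Rdiv_lt_0_compat; lra|].
  exists (max N1 N2). intros n Hn. specialize (H1 n ltac:(lia)). specialize (H2 n ltac:(lia)).
  replace (u n - k * v n - (l - k * m))%C with ((u n - l) + - (k * (v n - m)))%C by ring.
  eapply Rle_lt_trans; [apply Cmod_triangle|]. rewrite Cmod_opp, Cmod_mult.
  apply Rmult_lt_compat_r with (r := 2 * (Cmod k + 1)) in H2; [|lra].
  replace (eps / (2 * (Cmod k + 1)) * (2 * (Cmod k + 1))) with eps in H2 by (field; lra).
  pose proof (Cmod_ge_0 (v n - m)). nra.
Qed.

Lemma Cconverges_bound (u : nat -> C) (l : C) (B : R) :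
  Cconverges u l -> (forall n, Cmod (u n) <= B) -> Cmod l <= B.
Proof.
  intros Hu HB. apply Rnot_lt_le. intros H.
  destruct (Hu (Cmod l - B)) as [N HN]; [lra|]. specialize (HN N (le_n N)). specialize (HB N).
  pose proof (Cmod_triangle (u N) (- (u N - l))) as T. rewrite Cmod_opp in T.
  replace (u N + - (u N - l))%C with l in T by ring. lra.
Qed.

Lemma Cconverges_cauchy (u : nat -> C) (e : nat -> R) :
  is_lim_seq e 0 -> (forall n k : nat, Cmod (u (n + k)%nat - u n) <= e n) ->
  exists l, Cconverges u l.
Proof.
  intros He Hu.
  assert (Hsm : forall eps : posreal, exists N, forall n, (N <= n)%nat -> e n < eps).
  { intros eps. apply is_lim_seq_spec in He. destruct (He eps) as [N HN].
    exists N. intros n Hn. specialize (HN n Hn). rewrite Rminus_0_r in HN.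
    eapply Rle_lt_trans; [apply Rle_abs | exact HN]. }
  assert (Hcau : forall eps : posreal, exists N, forall n m, (N <= n)%nat -> (N <= m)%nat ->
     Cmod (u n - u m) < eps).
  { intros eps. destruct (Hsm eps) as [N HN]. exists N.
    assert (W : forall n m, (N <= n)%nat -> (n <= m)%nat -> Cmod (u m - u n) < eps).
    { intros n m Hn Hm. replace m with (n + (m - n))%nat by lia.
      eapply Rle_lt_trans; [apply Hu | apply HN, Hn]. }
    intros n m Hn Hm. destruct (Nat.le_gt_cases m n) as [C|C].
    - apply W; assumption.
    - rewrite <- Cmod_opp. replace (- (u n - u m))%C with (u m - u n)%C by ring. apply W; lia. }
  assert (Hre : ex_finite_lim_seq (fun n => Re (u n))).
  { apply ex_lim_seq_cauchy_corr. intros eps. destruct (Hcau eps) as [N HN]. exists N.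
    intros n m Hn Hm. eapply Rle_lt_trans; [exact (re_le_Cmod (u n - u m)) | auto]. }
  assert (Him : ex_finite_lim_seq (fun n => Im (u n))).
  { apply ex_lim_seq_cauchy_corr. intros eps. destruct (Hcau eps) as [N HN]. exists N.
    intros n m Hn Hm. eapply Rle_lt_trans; [exact (im_le_Cmod (u n - u m)) | auto]. }
  destruct Hre as [a Ha]. destruct Him as [b Hb]. exists (a, b). intros eps Heps.
  apply is_lim_seq_spec in Ha. apply is_lim_seq_spec in Hb.
  assert (Heps2 : 0 < eps / 2) by lra.
  destruct (Ha (mkposreal _ Heps2)) as [N1 H1]. destruct (Hb (mkposreal _ Heps2)) as [N2 H2].
  exists (max N1 N2). intros n Hn. specialize (H1 n ltac:(lia)). specialize (H2 n ltac:(lia)).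
  simpl in H1, H2.
  replace (u n - (a, b))%C with ((Re (u n) - a, Im (u n) - b) : C)
    by (unfold Cminus, Cplus, Copp; reflexivity).
  eapply Rle_lt_trans; [apply Cmod_le_Rabs | lra].
Qed.

Definition Clim_seq (u : nat -> C) : C :=
  (real (Lim_seq (fun n => Re (u n))), real (Lim_seq (fun n => Im (u n)))).

Lemma Clim_seq_unique (u : nat -> C) (l : C) : Cconverges u l -> Clim_seq u = l.
Proof.
  intros Hu. rewrite (surjective_pairing l). unfold Clim_seq.
  f_equal; change (real ?x = ?y) with (real x = real (Finite y)); f_equal;
    apply is_lim_seq_unique, is_lim_seq_spec; intros eps;
    destruct (Hu eps (cond_pos eps)) as [N HN]; exists N; intros n Hn;
    (eapply Rle_lt_trans; [| exact (HN n Hn)]).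
  - exact (re_le_Cmod (u n - l)).
  - exact (im_le_Cmod (u n - l)).
Qed.

(** * Summation by parts along log n *)

(** Dirichlet series and their derivatives in s are all of the form
    sum a(n) psi(log n), where psi is a polynomial times an exponential; one
    convergence theorem for this shape serves them all. *)
Definition log_sum (a : nat -> C) (psi : R -> C) : nat -> C :=
  partial_sum (fun n => a n * psi (ln (INR n)))%C.

Lemma ln_INR_S_ge_0 (n : nat) : 0 <= ln (INR (S n)).
Proof. rewrite <- ln_1. apply ln_le; [lra|]. change 1 with (INR 1). apply le_INR. lia. Qed.

Lemma ln_INR_S_le (n : nat) : ln (INR (S n)) <= ln (INR (S (S n))).
Proof. apply ln_le; [apply lt_0_INR; lia | apply le_INR; lia]. Qed.

Section Abel.

Variables (a : nat -> C) (K : R).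
Hypothesis Ha : forall n, Cmod (partial_sum a n) <= K.

Variables (psi psi' : R -> C) (B delta : R).
Hypothesis Hdelta : 0 < delta.
Hypothesis Hpsi : forall t, 0 <= t -> path_derive psi t (psi' t).
Hypothesis Hb : forall t, 0 <= t -> Cmod (psi t) <= B * exp (- delta * t).
Hypothesis Hb' : forall t, 0 <= t -> Cmod (psi' t) <= B * exp (- delta * t).

Let E (n : nat) : R := exp (- delta * ln (INR n)).

(** The bound telescopes, so the variation of psi along the sequence log n is summable
    without any comparison of series. *)
Lemma log_variation (n : nat) :
  Cmod (psi (ln (INR (S n))) - psi (ln (INR (S (S n))))) <= B / delta * (E (S n) - E (S (S n))).
Proof.
  rewrite <- Cmod_opp.
  replace (- (psi (ln (INR (S n))) - psi (ln (INR (S (S n))))))%C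
    with (psi (ln (INR (S (S n)))) - psi (ln (INR (S n))))%C by ring.
  replace (B / delta * (E (S n) - E (S (S n)))) with
    (- (B / delta) * exp (- delta * ln (INR (S (S n)))) -
     - (B / delta) * exp (- delta * ln (INR (S n)))) by (unfold E; ring).
  pose proof (ln_INR_S_ge_0 n) as H0.
  apply (path_variation psi psi' (fun t => - (B / delta) * exp (- delta * t))
    (fun t => B * exp (- delta * t))).
  - apply ln_INR_S_le.
  - intros t Ht. apply Hpsi. lra.
  - intros t _. auto_derive; [exact I | field; lra].
  - intros t Ht. apply Hb'. lra.
Qed.

(** Summation by parts: with A the partial sums of a, the corrected sum
    S(n) - A(n) psi(log(n+1)) changes from n to n + 1 by
    A(n+1) (psi(log(n+1)) - psi(log(n+2))), which [log_variation] controls. *)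
Lemma abel_tail (n k : nat) :
  Cmod (log_sum a psi (n + k) - log_sum a psi n) <= K * B * (2 + / delta) * E (S n).
Proof.
  assert (HK : 0 <= K) by (eapply Rle_trans; [apply Cmod_ge_0 | apply (Ha O)]).
  assert (HB : 0 <= B).
  { pose proof (Rle_trans _ _ _ (Cmod_ge_0 _) (Hb 0 (Rle_refl 0))) as H.
    rewrite Rmult_0_r, exp_0, Rmult_1_r in H. exact H. }
  set (T := fun n => (log_sum a psi n - partial_sum a n * psi (ln (INR (S n))))%C).
  assert (HT : Cmod (T (n + k)%nat - T n) <= K * (B / delta) * (E (S n) - E (S (n + k)))).
  { induction k as [|k IH].
    - rewrite Nat.add_0_r. unfold Cminus. rewrite Cplus_opp_r, Cmod_0. lra.
    - rewrite Nat.add_succ_r. set (m := (n + k)%nat) in *.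
      replace (T (S m) - T n)%C with ((T m - T n) +
        partial_sum a (S m) * (psi (ln (INR (S m))) - psi (ln (INR (S (S m))))))%C
        by (unfold T; change (log_sum a psi (S m)) with
          (log_sum a psi m + a (S m) * psi (ln (INR (S m))))%C;
          change (partial_sum a (S m)) with (partial_sum a m + a (S m))%C; ring).
      eapply Rle_trans; [apply Cmod_triangle|].
      replace (K * (B / delta) * (E (S n) - E (S (S m)))) with
        (K * (B / delta) * (E (S n) - E (S m)) + K * (B / delta * (E (S m) - E (S (S m)))))
        by ring.
      apply Rplus_le_compat; [exact IH|]. rewrite Cmod_mult.
      apply Rmult_le_compat; [apply Cmod_ge_0 | apply Cmod_ge_0 | apply Ha | apply log_variation]. }
  assert (HE : forall j, 0 < E j) by (intros j; apply exp_pos).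
  assert (Hmono : E (S (n + k)) <= E (S n)).
  { apply exp_nondecreasing.
    assert (ln (INR (S n)) <= ln (INR (S (n + k)))); [|nra].
    apply ln_le; [apply lt_0_INR; lia | apply le_INR; lia]. }
  assert (Hbd : forall m, Cmod (partial_sum a m * psi (ln (INR (S m)))) <= K * (B * E (S m))).
  { intros m. rewrite Cmod_mult. apply Rmult_le_compat;
      [apply Cmod_ge_0 | apply Cmod_ge_0 | apply Ha | apply Hb, ln_INR_S_ge_0]. }
  replace (log_sum a psi (n + k) - log_sum a psi n)%C with ((T (n + k)%nat - T n) +
    (partial_sum a (n + k) * psi (ln (INR (S (n + k)))) +
      - (partial_sum a n * psi (ln (INR (S n))))))%C by (unfold T; ring).
  eapply Rle_trans; [apply Cmod_triangle|].
  pose proof (Cmod_triangle (partial_sum a (n + k) * psi (ln (INR (S (n + k)))))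
    (- (partial_sum a n * psi (ln (INR (S n)))))) as Htri. rewrite Cmod_opp in Htri.
  pose proof (Hbd (n + k)%nat) as H1. pose proof (Hbd n) as H2.
  assert (HKB : 0 <= K * B) by nra.
  assert (HKd : 0 <= K * (B / delta)).
  { apply Rmult_le_pos; [exact HK|]. apply Rmult_le_pos; [exact HB|].
    left; apply Rinv_0_lt_compat, Hdelta. }
  pose proof (HE (S (n + k))). pose proof (HE (S n)).
  replace (K * B * (2 + / delta) * E (S n)) with
    (K * (B / delta) * E (S n) + 2 * (K * B * E (S n))) by (field; lra).
  assert (H3 : K * B * E (S (n + k)) <= K * B * E (S n)) by (apply Rmult_le_compat_l; assumption).
  assert (H4 : K * (B / delta) * (E (S n) - E (S (n + k))) <= K * (B / delta) * E (S n))
    by (apply Rmult_le_compat_l; lra).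
  lra.
Qed.

Lemma exp_ln_tends_to_0 : is_lim_seq (fun n => E (S n)) 0.
Proof.
  unfold E. apply (is_lim_comp_seq exp (fun n => - delta * ln (INR (S n))) m_infty 0).
  - apply is_lim_exp_m.
  - exists O. intros n _. discriminate.
  - replace m_infty with (Rbar_mult (- delta) p_infty).
    + apply is_lim_seq_scal_l.
      apply (is_lim_comp_seq ln (fun n => INR (S n)) p_infty p_infty).
      * apply is_lim_ln_p.
      * exists O. intros n _. discriminate.
      * apply (is_lim_seq_incr_1 INR), is_lim_seq_INR.
    + rewrite Rbar_mult_comm. apply is_Rbar_mult_unique, is_Rbar_mult_p_infty_neg. simpl. lra.
Qed.

Lemma log_sum_converges :
  exists l, Cconverges (log_sum a psi) l /\ Cmod l <= K * B * (2 + / delta).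
Proof.
  destruct (Cconverges_cauchy (log_sum a psi) (fun n => K * B * (2 + / delta) * E (S n)))
    as [l Hl].
  - replace (Finite 0) with (Rbar_mult (K * B * (2 + / delta)) 0) by (simpl; f_equal; ring).
    apply is_lim_seq_scal_l, exp_ln_tends_to_0.
  - exact abel_tail.
  - exists l. split; [exact Hl|]. apply (Cconverges_bound _ l _ Hl).
    intros n. pose proof (abel_tail 0 n) as H. rewrite Nat.add_0_l in H.
    replace (log_sum a psi n - log_sum a psi 0)%C with (log_sum a psi n) in H
      by (unfold log_sum at 3; simpl; ring).
    unfold E in H. rewrite INR_1, ln_1, Rmult_0_r, exp_0, Rmult_1_r in H.
    exact H.
Qed.

End Abel.

(** * Dirichlet series with bounded coefficient sums *)

(** Used to absorb powers of log n into a small power of n. *)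
Lemma le_exp_div (eta t : R) : 0 < eta -> 0 <= t -> t <= / eta * exp (eta * t).
Proof.
  intros He Ht. pose proof (exp_ineq1_le (eta * t)).
  apply Rmult_le_reg_l with eta; [exact He|].
  rewrite <- Rmult_assoc, Rinv_r, Rmult_1_l by lra. lra.
Qed.

Lemma Cmod_Cexp_path (s : C) (t : R) : Cmod (Cexp (t * - s)) = exp (- Re s * t).
Proof. rewrite Cmod_Cexp, re_scal_l, re_opp. f_equal. ring. Qed.

(** The three quarters of the decay e^{-Re(s) t} that are given up pay for the factor
    e^{|th|} and for at most two factors t. *)
Lemma taylor_remainder_bound (s h : C) (t : R) :
  0 < Re s -> Cmod h <= Re s / 4 -> 0 <= t ->
  Cmod (Cexp (t * h) - 1 - t * h) * exp (- Re s * t) <=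
    Cmod h ^ 2 * (16 / Re s ^ 2) * exp (- (Re s / 4) * t) /\
  Cmod (h * Cexp (t * h) - h) * exp (- Re s * t) <=
    Cmod h ^ 2 * (4 / Re s) * exp (- (Re s / 4) * t).
Proof.
  set (sigma := Re s). intros Hs Hh Ht. pose proof (Cmod_ge_0 h) as Hh0.
  assert (Hm : Cmod (t * h) = t * Cmod h) by (rewrite Cmod_mult, Cmod_R, Rabs_pos_eq; auto).
  set (m := Cmod h) in *.
  assert (Hs4 : 0 < sigma / 4) by lra. pose proof (le_exp_div (sigma / 4) t Hs4 Ht) as H.
  replace (/ (sigma / 4)) with (4 / sigma) in H by (field; lra).
  assert (HX1 : 1 <= exp (sigma / 4 * t)).
  { pose proof (exp_ineq1_le (sigma / 4 * t)). nra. }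
  assert (He : exp (t * m) <= exp (sigma / 4 * t)) by (apply exp_nondecreasing; nra).
  replace (- sigma * t) with (- (sigma / 4) * t + - (sigma / 4 * t) + - (sigma / 4 * t)
    + - (sigma / 4 * t)) by field.
  rewrite !exp_plus, !exp_Ropp.
  set (X := exp (sigma / 4 * t)) in *. set (Y := exp (- (sigma / 4) * t)).
  assert (HY : 0 < Y) by apply exp_pos.
  assert (Hc : 0 < 4 / sigma) by (apply Rdiv_lt_0_compat; lra).
  pose proof (Cexp_minus_affine_bound (t * h)) as B1. rewrite Hm in B1.
  pose proof (Cexp_minus_1_bound (t * h)) as B2. rewrite Hm in B2.
  assert (HX3 : 0 < X * X * X) by (repeat apply Rmult_lt_0_compat; lra).
  assert (Hdiv : forall u v, u <= v * (X * X * X) -> u * (Y * / X * / X * / X) <= v * Y).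
  { intros u v Huv. replace (u * (Y * / X * / X * / X)) with (u * / (X * X * X) * Y)
      by (field; lra).
    apply Rmult_le_compat_r; [lra|]. apply Rmult_le_reg_r with (X * X * X); [exact HX3|].
    rewrite Rmult_assoc, Rinv_l, Rmult_1_r by lra. exact Huv. }
  split; apply Hdiv.
  - eapply Rle_trans; [exact B1|].
    replace (m ^ 2 * (16 / sigma ^ 2) * (X * X * X))
      with ((m ^ 2 * (4 / sigma * X) ^ 2) * X) by (field; lra).
    apply Rmult_le_compat; [apply pow2_ge_0 | left; apply exp_pos | | exact He].
    rewrite Rpow_mult_distr, Rmult_comm. apply Rmult_le_compat_l; [apply pow2_ge_0|].
    apply pow_incr. lra.
  - replace (h * Cexp (t * h) - h)%C with (h * (Cexp (t * h) - 1))%C by ring.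
    rewrite Cmod_mult. fold m.
    replace (m ^ 2 * (4 / sigma) * (X * X * X)) with (m * (m * (4 / sigma * X) * X * X))
      by (field; lra).
    apply Rmult_le_compat_l; [exact Hh0|]. eapply Rle_trans; [exact B2|].
    assert (A1 : t * m * exp (t * m) <= m * (4 / sigma * X) * X).
    { apply Rmult_le_compat; [nra | left; apply exp_pos | nra | exact He]. }
    assert (A2 : 0 <= m * (4 / sigma * X) * X) by (repeat apply Rmult_le_pos; lra).
    nra.
Qed.

Definition dirichlet_series (a : nat -> C) (s : C) : C :=
  Clim_seq (log_sum a (fun t => Cexp (t * - s))).

Section Dirichlet.

Variables (a : nat -> C) (K : R).
Hypothesis Ha : forall n, Cmod (partial_sum a n) <= K.

Lemma dirichlet_series_converges (s : C) : 0 < Re s ->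
  Cconverges (log_sum a (fun t => Cexp (t * - s))) (dirichlet_series a s).
Proof.
  intros Hs.
  destruct (log_sum_converges a K Ha (fun t => Cexp (t * - s)) (fun t => - s * Cexp (t * - s))%C
    (1 + Cmod s) (Re s)) as [l [Hl _]].
  - exact Hs.
  - intros t _. apply path_derive_Cexp.
  - intros t _. rewrite Cmod_Cexp_path. pose proof (Cmod_ge_0 s).
    pose proof (exp_pos (- Re s * t)). nra.
  - intros t _. rewrite Cmod_mult, Cmod_opp, Cmod_Cexp_path.
    pose proof (exp_pos (- Re s * t)). nra.
  - unfold dirichlet_series. rewrite (Clim_seq_unique _ l Hl). exact Hl.
Qed.

Lemma log_series_converges (s : C) : 0 < Re s ->
  exists l, Cconverges (log_sum a (fun t => - (t * Cexp (t * - s)))%C) l.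
Proof.
  intros Hs. set (sigma := Re s) in *.
  destruct (log_sum_converges a K Ha (fun t => 0 - t * Cexp (t * - s))%C
    (fun t => 0 - (1 * Cexp (t * - s) + t * (- s * Cexp (t * - s))))%C
    (1 + (1 + Cmod s) * (2 / sigma)) (sigma / 2)) as [l [Hl _]].
  - lra.
  - intros t _. apply path_derive_minus; [apply path_derive_const|].
    apply (path_derive_mult RtoC (fun t => Cexp (t * - s)));
      [apply path_derive_id | apply path_derive_Cexp].
  - intros t Ht. replace (0 - t * Cexp (t * - s))%C with (- (t * Cexp (t * - s)))%C by ring.
    rewrite Cmod_opp, Cmod_mult, Cmod_R, Rabs_pos_eq, Cmod_Cexp_path by exact Ht. fold sigma.
    assert (Hs2 : 0 < sigma / 2) by lra. pose proof (le_exp_div (sigma / 2) t Hs2 Ht) as H.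
    replace (/ (sigma / 2)) with (2 / sigma) in H by (field; lra).
    replace (- sigma * t) with (- (sigma / 2) * t + - (sigma / 2 * t)) by field.
    rewrite exp_plus, exp_Ropp.
    set (X := exp (sigma / 2 * t)) in *. set (Y := exp (- (sigma / 2) * t)).
    assert (0 < X) by apply exp_pos. assert (0 < Y) by apply exp_pos.
    replace (t * (Y * / X)) with (t * / X * Y) by ring.
    apply Rmult_le_compat_r; [lra|].
    apply Rmult_le_reg_r with X; [assumption|]. rewrite Rmult_assoc, Rinv_l, Rmult_1_r by lra.
    eapply Rle_trans; [exact H|]. apply Rmult_le_compat_r; [lra|].
    assert (0 < 2 / sigma) by (apply Rdiv_lt_0_compat; lra). pose proof (Cmod_ge_0 s). nra.
  - intros t Ht.
    replace (0 - (1 * Cexp (t * - s) + t * (- s * Cexp (t * - s))))%C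
      with ((t * s - 1) * Cexp (t * - s))%C by ring.
    rewrite Cmod_mult, Cmod_Cexp_path. fold sigma.
    assert (H1 : Cmod (t * s - 1) <= t * Cmod s + 1).
    { eapply Rle_trans; [apply Cmod_triangle|].
      rewrite Cmod_opp, Cmod_1, Cmod_mult, Cmod_R, Rabs_pos_eq by exact Ht. lra. }
    assert (Hs2 : 0 < sigma / 2) by lra. pose proof (le_exp_div (sigma / 2) t Hs2 Ht) as H.
    replace (/ (sigma / 2)) with (2 / sigma) in H by (field; lra).
    assert (HX1 : 1 <= exp (sigma / 2 * t)).
    { pose proof (exp_ineq1_le (sigma / 2 * t)). nra. }
    replace (- sigma * t) with (- (sigma / 2) * t + - (sigma / 2 * t)) by field.
    rewrite exp_plus, exp_Ropp.
    set (X := exp (sigma / 2 * t)) in *. set (Y := exp (- (sigma / 2) * t)).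
    assert (0 < Y) by apply exp_pos.
    replace (Cmod (t * s - 1) * (Y * / X)) with (Cmod (t * s - 1) * / X * Y) by ring.
    apply Rmult_le_compat_r; [lra|].
    apply Rmult_le_reg_r with X; [lra|]. rewrite Rmult_assoc, Rinv_l, Rmult_1_r by lra.
    eapply Rle_trans; [exact H1|].
    assert (0 < 2 / sigma) by (apply Rdiv_lt_0_compat; lra). pose proof (Cmod_ge_0 s).
    assert (t * Cmod s <= 2 / sigma * X * Cmod s) by (apply Rmult_le_compat_r; assumption).
    assert (0 <= 2 / sigma * X) by nra. nra.
  - exists l. intros eps Heps. destruct (Hl eps Heps) as [N HN]. exists N. intros n Hn.
    replace (log_sum a (fun t => - (t * Cexp (t * - s)))%C n)
      with (log_sum a (fun t => 0 - t * Cexp (t * - s))%C n); [apply HN, Hn|].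
    apply partial_sum_ext. intros j _. ring.
Qed.

(** The Taylor remainder of the series is the series of the Taylor remainders phi.  As
    phi and its derivative carry the factor |h|^2, so does the bound of
    [log_sum_converges]. *)
Lemma dirichlet_series_derive (s : C) : 0 < Re s ->
  exists l, Cconverges (log_sum a (fun t => - (t * Cexp (t * - s)))%C) l /\
    @is_derive C_AbsRing C_NormedModule (dirichlet_series a) s l.
Proof.
  intros Hs. destruct (log_series_converges s Hs) as [l Hl]. exists l. split; [exact Hl|].
  set (sigma := Re s) in *.
  apply (is_derive_of_quadratic_bound _ s l (sigma / 4)
    (K * (16 / sigma ^ 2 * (1 + Cmod s) + 4 / sigma) * (2 + / (sigma / 4)))); [lra|].
  intros w Hw. set (h := (w - s)%C) in *. set (k := (- h)%C).
  assert (Hk : Cmod k = Cmod h) by apply Cmod_opp.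
  assert (Hw0 : 0 < Re w).
  { pose proof (Rle_trans _ _ _ (Rle_abs (Re k)) (re_le_Cmod k)) as H.
    rewrite Hk in H.
    assert (E : Re k = sigma - Re w) by (unfold sigma, k, h, Re, Cminus; simpl; ring).
    lra. }
  pose (phi := fun t : R => (Cexp (t * - s) * (Cexp (t * k) - 1 - t * k))%C).
  pose (phi' := fun t : R => (- s * Cexp (t * - s) * (Cexp (t * k) - 1 - t * k) +
    Cexp (t * - s) * (k * Cexp (t * k) - 0 - k))%C).
  assert (Hhk : Cmod k <= sigma / 4) by lra.
  destruct (log_sum_converges a K Ha phi phi'
    (Cmod h ^ 2 * (16 / sigma ^ 2 * (1 + Cmod s) + 4 / sigma)) (sigma / 4)) as [l' [Hl' Hb]].
  - lra.
  - intros t _. apply (path_derive_mult (fun t => Cexp (t * - s))%C); [apply path_derive_Cexp|].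
    apply path_derive_minus; [|apply path_derive_line].
    apply path_derive_minus; [apply path_derive_Cexp | apply path_derive_const].
  - intros t Ht. unfold phi. rewrite Cmod_mult, Cmod_Cexp_path.
    destruct (taylor_remainder_bound s k t Hs Hhk Ht) as [B1 _]. fold sigma in B1 |- *.
    rewrite Hk in B1. rewrite Rmult_comm. eapply Rle_trans; [exact B1|].
    apply Rmult_le_compat_r; [left; apply exp_pos|].
    apply Rmult_le_compat_l; [apply pow2_ge_0|].
    assert (0 < 4 / sigma) by (apply Rdiv_lt_0_compat; lra).
    assert (0 < 16 / sigma ^ 2) by (apply Rdiv_lt_0_compat; [lra | apply pow_lt, Hs]).
    pose proof (Cmod_ge_0 s). nra.
  - intros t Ht. unfold phi'.
    destruct (taylor_remainder_bound s k t Hs Hhk Ht) as [B1 B2]. fold sigma in B1, B2.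
    rewrite Hk in B1, B2.
    eapply Rle_trans; [apply Cmod_triangle|].
    replace (k * Cexp (t * k) - 0 - k)%C with (k * Cexp (t * k) - k)%C by ring.
    rewrite !Cmod_mult, Cmod_opp, Cmod_Cexp_path. fold sigma.
    rewrite (Rmult_comm (exp _) (Cmod (k * Cexp (t * k) - k))).
    rewrite Rmult_assoc, (Rmult_comm (exp _) (Cmod (Cexp (t * k) - 1 - t * k))).
    set (Y := exp (- (sigma / 4) * t)) in *. assert (HY : 0 < Y) by apply exp_pos.
    apply Rmult_le_compat_l with (r := Cmod s) in B1; [|apply Cmod_ge_0].
    assert (0 < 16 / sigma ^ 2) by (apply Rdiv_lt_0_compat; [lra | apply pow_lt, Hs]).
    assert (0 <= Cmod h ^ 2 * (16 / sigma ^ 2) * Y).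
    { apply Rmult_le_pos; [apply Rmult_le_pos; [apply pow2_ge_0 | lra] | lra]. }
    lra.
  - (* the limit [l'] is the Taylor remainder of the series *)
    assert (El : l' = (dirichlet_series a w - dirichlet_series a s - l * h)%C).
    { apply (Cconverges_unique (log_sum a phi)); [exact Hl'|].
      pose proof (Cconverges_lin _ _ _ _ h (Cconverges_lin _ _ _ _ 1
        (dirichlet_series_converges w Hw0) (dirichlet_series_converges s Hs)) Hl) as Hlin.
      replace (dirichlet_series a w - dirichlet_series a s - l * h)%C
        with (dirichlet_series a w - 1 * dirichlet_series a s - h * l)%C by ring.
      intros eps Heps. destruct (Hlin eps Heps) as [N HN]. exists N. intros n Hn.
      specialize (HN n Hn). cbv beta in HN.
      replace (log_sum a phi n) with (log_sum a (fun t => Cexp (t * - w)) n -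
        1 * log_sum a (fun t => Cexp (t * - s)) n -
        h * log_sum a (fun t => - (t * Cexp (t * - s)))%C n)%C; [exact HN|].
      unfold log_sum. rewrite Cmult_1_l, <- partial_sum_lin. apply partial_sum_ext.
      intros j _. unfold phi. set (t := ln (INR j)).
      replace (t * - w)%C with (t * - s + t * k)%C by (unfold k, h; ring).
      rewrite Cexp_plus. unfold k. ring. }
    rewrite <- El. eapply Rle_trans; [exact Hb|]. right. ring.
Qed.

End Dirichlet.

(** * The coefficients of zeta_(c) and the continuation of zeta *)

Lemma Cconverges_filterlim (u : nat -> C) (l : C) :
  Cconverges u l <-> filterlim u eventually (@locally C_UniformSpace l).
Proof.
  split.
  - intros H. apply (filterlim_locally_ball_norm (K := C_AbsRing) (U := C_NormedModule)).
    intros eps. exact (H eps (cond_pos eps)).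
  - intros H eps Heps.
    exact (proj1 (filterlim_locally_ball_norm (K := C_AbsRing) (U := C_NormedModule) u l) H
      (mkposreal eps Heps)).
Qed.

Lemma inv_nat_Cpow (n : nat) (s : C) : (/ nat_Cpow n s)%C = Cexp (ln (INR n) * - s).
Proof. unfold nat_Cpow. rewrite <- Cexp_opp. f_equal. ring. Qed.

Lemma sum_n_partial_sum (f : nat -> C) (N : nat) :
  @sum_n C_AbelianMonoid (fun k => f (S k)) N = partial_sum f (S N).
Proof.
  induction N as [|N IH].
  - rewrite sum_O. simpl. ring.
  - rewrite sum_Sn, IH. reflexivity.
Qed.

Lemma succ_div_mod (c M : nat) : (1 <= c)%nat ->
  if (S M mod c =? 0)%nat
  then (S M / c = S (M / c) /\ c * (S M / c) = S M /\ M mod c = c - 1)%nat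
  else (S M / c = M / c /\ S M mod c = S (M mod c))%nat.
Proof.
  intros Hc. pose proof (Nat.div_mod_eq (S M) c) as E.
  pose proof (Nat.mod_upper_bound (S M) c ltac:(lia)) as Hu.
  destruct (Nat.eqb_spec (S M mod c) 0) as [H0|H0].
  - rewrite H0, Nat.add_0_r in E.
    destruct (S M / c)%nat as [|q] eqn:Eq; [lia|].
    assert (EM : (M = c * q + (c - 1))%nat) by nia.
    rewrite <- (Nat.div_unique M c q (c - 1)) by (lia || exact EM).
    rewrite <- (Nat.mod_unique M c q (c - 1)) by (lia || exact EM).
    repeat split; lia.
  - set (q := (S M / c)%nat) in *. set (r := (S M mod c)%nat) in *.
    assert (EM : (M = c * q + (r - 1))%nat) by lia.
    rewrite <- (Nat.div_unique M c q (r - 1)) by (lia || exact EM).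
    rewrite <- (Nat.mod_unique M c q (r - 1)) by (lia || exact EM).
    split; lia.
Qed.

Definition zeta_c_coef (c n : nat) : C := RtoC (a_coef c n).

Lemma partial_sum_zeta_c_coef (c M : nat) : (1 <= c)%nat ->
  partial_sum (zeta_c_coef c) M = RtoC (INR (M mod c)).
Proof.
  intros Hc. induction M as [|M IH].
  - rewrite Nat.Div0.mod_0_l. reflexivity.
  - simpl partial_sum. rewrite IH. unfold zeta_c_coef, a_coef.
    pose proof (succ_div_mod c M Hc) as H.
    destruct (Nat.eqb_spec (S M mod c) 0) as [H0|H0].
    + destruct H as (_ & _ & ->). rewrite H0, minus_INR by exact Hc.
      rewrite <- RtoC_plus. f_equal. simpl. ring.
    + destruct H as [_ ->]. rewrite <- RtoC_plus, S_INR. reflexivity.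
Qed.

Lemma partial_sum_zeta_c_coef_bound (c M : nat) : (1 <= c)%nat ->
  Cmod (partial_sum (zeta_c_coef c) M) <= INR c.
Proof.
  intros Hc. rewrite partial_sum_zeta_c_coef, Cmod_R by exact Hc.
  rewrite Rabs_pos_eq by apply pos_INR.
  apply le_INR. pose proof (Nat.mod_upper_bound M c ltac:(lia)). lia.
Qed.

(** The coefficient differs from 1 only at multiples of c, by - c. *)
Lemma partial_sum_sieve (c : nat) (f : nat -> C) (M : nat) : (1 <= c)%nat ->
  partial_sum (fun n => zeta_c_coef c n * f n)%C M =
  (partial_sum f M - INR c * partial_sum (fun m => f (c * m)%nat) (M / c))%C.
Proof.
  intros Hc. induction M as [|M IH].
  - rewrite Nat.Div0.div_0_l. simpl. ring.
  - simpl partial_sum at 1 2. rewrite IH. unfold zeta_c_coef, a_coef.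
    pose proof (succ_div_mod c M Hc) as H.
    destruct (S M mod c =? 0)%nat.
    + destruct H as (H1 & H2 & _). rewrite H1 in H2. rewrite H1.
      simpl partial_sum. rewrite H2, RtoC_minus. ring.
    + destruct H as [-> _]. ring.
Qed.

Lemma ln_INR_mult (c m : nat) : (1 <= c)%nat -> (1 <= m)%nat ->
  ln (INR (c * m)) = ln (INR c) + ln (INR m).
Proof. intros Hc Hm. rewrite mult_INR. apply ln_mult; apply lt_0_INR; lia. Qed.

Lemma INR_mult_Cexp (c : nat) (s : C) : (1 <= c)%nat ->
  (INR c * Cexp (ln (INR c) * - s))%C = nat_Cpow c (1 - s).
Proof.
  intros Hc. unfold nat_Cpow.
  replace ((1 - s) * ln (INR c))%C with (ln (INR c) + ln (INR c) * - s)%C by ring.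
  rewrite Cexp_plus. f_equal. unfold Cexp. rewrite re_RtoC, im_RtoC, cos_0, sin_0.
  rewrite exp_ln by (apply lt_0_INR; lia). unfold RtoC. f_equal; ring.
Qed.

Section Zeta.

Variables (zeta : C -> C) (c : nat).
Hypothesis Hzeta : is_riemann_zeta zeta.
Hypothesis Hc : (1 <= c)%nat.

Lemma zeta_converges (s : C) : 1 < Re s ->
  Cconverges (partial_sum (fun n => Cexp (ln (INR n) * - s))) (zeta s).
Proof.
  intros Hs. destruct Hzeta as (_ & _ & Hser). specialize (Hser s Hs).
  apply Cconverges_filterlim in Hser. intros eps Heps.
  destruct (Hser eps Heps) as [N HN]. exists (S N). intros n Hn.
  destruct n as [|n]; [lia|]. specialize (HN n ltac:(lia)).
  rewrite <- sum_n_partial_sum.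
  erewrite sum_n_ext; [exact HN|]. intros k. symmetry. apply inv_nat_Cpow.
Qed.

Lemma dirichlet_series_zeta_c_coef (s : C) : 1 < Re s ->
  dirichlet_series (zeta_c_coef c) s = ((1 - nat_Cpow c (1 - s)) * zeta s)%C.
Proof.
  intros Hs. apply Clim_seq_unique.
  replace ((1 - nat_Cpow c (1 - s)) * zeta s)%C
    with (zeta s - nat_Cpow c (1 - s) * zeta s)%C by ring.
  assert (Hsub : Cconverges (fun M => partial_sum (fun n => Cexp (ln (INR n) * - s)) (M / c))
    (zeta s)).
  { apply (Cconverges_subseq _ _ (fun M => M / c)%nat (zeta_converges s Hs)).
    intros N. exists (N * c)%nat. intros n Hn. apply Nat.div_le_lower_bound; lia. }
  pose proof (Cconverges_lin _ _ _ _ (nat_Cpow c (1 - s)) (zeta_converges s Hs) Hsub) as H.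
  intros eps Heps. destruct (H eps Heps) as [N HN]. exists N. intros n Hn.
  specialize (HN n Hn). cbv beta in HN. unfold log_sum. rewrite partial_sum_sieve by exact Hc.
  rewrite (partial_sum_ext (fun m => Cexp (ln (INR (c * m)) * - s))
    (fun m => 0 - 0 - - Cexp (ln (INR c) * - s) * Cexp (ln (INR m) * - s))%C).
  - rewrite (partial_sum_lin (fun _ => 0) (fun _ => 0)).
    match goal with |- Cmod (?x - _) < _ => replace x with
      (partial_sum (fun n => Cexp (ln (INR n) * - s)) n -
       (INR c * Cexp (ln (INR c) * - s)) * partial_sum (fun n => Cexp (ln (INR n) * - s)) (n / c))%C
       by ring end.
    rewrite INR_mult_Cexp by exact Hc. exact HN.
  - intros m Hm. rewrite ln_INR_mult by assumption.
    rewrite RtoC_plus, Cmult_plus_distr_r, Cexp_plus. ring.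
Qed.

Lemma holomorphic_dirichlet_zeta_c_coef (z : C) : 0 < Re z ->
  holomorphic_at (dirichlet_series (zeta_c_coef c)) z.
Proof.
  intros Hz. destruct (dirichlet_series_derive (zeta_c_coef c) (INR c)) with (s := z) as [l [_ Hl]].
  - intros n. apply partial_sum_zeta_c_coef_bound, Hc.
  - exact Hz.
  - exists l. exact Hl.
Qed.

Lemma holomorphic_one_minus_Cpow (z : C) :
  holomorphic_at (fun w => 1 - nat_Cpow c (1 - w))%C z.
Proof.
  apply holomorphic_at_minus; [apply holomorphic_at_const|].
  apply (holomorphic_at_comp Cexp (fun w => (1 - w) * ln (INR c))%C); [apply holomorphic_at_Cexp|].
  apply holomorphic_at_mult; [|apply holomorphic_at_const].
  apply holomorphic_at_minus; [apply holomorphic_at_const | apply holomorphic_at_id].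
Qed.

(** Here h(z) = (z - 1)^k zeta(z) near 1.  The function H is (z - 1)^k times the
    difference of the two sides, continued through z = 1 by means of h, and
    [half_plane_identity] applies to it. *)
Lemma zeta_eq_dirichlet_series (z : C) : 0 < Re z -> z <> 1 ->
  ((1 - nat_Cpow c (1 - z)) * zeta z)%C = dirichlet_series (zeta_c_coef c) z.
Proof.
  set (D := dirichlet_series (zeta_c_coef c)).
  destruct Hzeta as (Hhol & (k & r & h & Hr & Hh) & _).
  set (H := fun z : C => if Ceq_dec z 1
    then ((1 - nat_Cpow c (1 - z)) * h z - (z - 1) ^ k * D z)%C
    else ((z - 1) ^ k * ((1 - nat_Cpow c (1 - z)) * zeta z - D z))%C).
  assert (HD : forall w, 0 < Re w -> holomorphic_at D w) by apply holomorphic_dirichlet_zeta_c_coef.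
  assert (Hpow : forall w, holomorphic_at (fun z => (z - 1) ^ k)%C w).
  { intros w. apply (holomorphic_at_pow (fun z => z - 1)%C).
    apply holomorphic_at_minus; [apply holomorphic_at_id | apply holomorphic_at_const]. }
  assert (H0 : forall w, 0 < Re w -> H w = 0).
  { apply half_plane_identity.
    - intros w Hw. destruct (Ceq_dec w 1) as [E|N].
      + apply (holomorphic_at_ext_loc
          (fun z => (1 - nat_Cpow c (1 - z)) * h z - (z - 1) ^ k * D z)%C _ _ r Hr).
        * intros v Hv. unfold H. destruct (Ceq_dec v 1) as [E'|N']; [reflexivity|].
          rewrite E in Hv. destruct (Hh v Hv) as [_ Eh]. rewrite (Eh N'). ring.
        * apply holomorphic_at_minus; apply holomorphic_at_mult.
          -- apply holomorphic_one_minus_Cpow.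
          -- apply Hh. rewrite E. unfold Cminus. rewrite Cplus_opp_r, Cmod_0. exact Hr.
          -- apply Hpow.
          -- apply HD, Hw.
      + assert (Hw1 : 0 < Cmod (w - 1)) by (apply Cmod_gt_0, Cminus_eq_contra, N).
        apply (holomorphic_at_ext_loc
          (fun z => (z - 1) ^ k * ((1 - nat_Cpow c (1 - z)) * zeta z - D z))%C _ _ _ Hw1).
        * intros v Hv. unfold H. destruct (Ceq_dec v 1) as [E'|N']; [|reflexivity].
          exfalso. rewrite E', <- Cmod_opp in Hv.
          replace (- (1 - w))%C with (w - 1)%C in Hv by ring. lra.
        * apply holomorphic_at_mult; [apply Hpow|]. apply holomorphic_at_minus; [|apply HD, Hw].
          apply holomorphic_at_mult; [apply holomorphic_one_minus_Cpow | apply Hhol, N].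
    - intros w Hw. unfold H. destruct (Ceq_dec w 1) as [E|N].
      + rewrite E in Hw. simpl in Hw. lra.
      + unfold D. rewrite dirichlet_series_zeta_c_coef by exact Hw. ring. }
  intros Hz N. specialize (H0 z Hz). unfold H in H0.
  destruct (Ceq_dec z 1) as [E|_]; [contradiction|].
  apply Ceq_minus. destruct (Ceq_dec ((1 - nat_Cpow c (1 - z)) * zeta z - D z) 0) as [E|NE];
    [exact E|].
  exfalso. revert H0. apply Cmult_neq_0; [apply Cpow_nz, Cminus_eq_contra, N | exact NE].
Qed.

(** At 1 the value of zeta_(c) is a limit along the punctured neighbourhood, where it
    agrees with the continuous function D. *)
Lemma zeta_c_eq_dirichlet_series (z : C) : 0 < Re z ->
  zeta_c zeta c z = dirichlet_series (zeta_c_coef c) z.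
Proof.
  intros Hz. unfold zeta_c. destruct (Ceq_dec z 1) as [->|N].
  - apply is_C_lim_unique.
    apply (filterlim_ext_loc (dirichlet_series (zeta_c_coef c))).
    + exists (mkposreal 1 Rlt_0_1). intros w Hw Hw1. symmetry. apply zeta_eq_dirichlet_series; [|exact Hw1].
      destruct Hw as [Hw _]. unfold ball in Hw; simpl in Hw.
      unfold AbsRing_ball, abs, minus, plus, opp in Hw; simpl in Hw.
      apply Rabs_lt_between in Hw. unfold Re. lra.
    + apply (filterlim_filter_le_1 (F := @locally C_UniformSpace (RtoC 1))); [apply filter_le_within|].
      apply (filterlim_locally_ball_norm (K := C_AbsRing) (U := C_NormedModule)). intros eps.
      destruct (holomorphic_at_continuous _ _ (holomorphic_dirichlet_zeta_c_coef 1 Hz) eps (cond_pos eps))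
        as [d [Hd0 Hd]].
      apply locally_C. exists (mkposreal d Hd0). exact Hd.
  - apply zeta_eq_dirichlet_series; assumption.
Qed.

End Zeta.

Lemma partial_prod_Cexp (f u : nat -> C) (M : nat) :
  (forall n, (1 <= n)%nat -> f n = Cexp (u n)) ->
  partial_prod f M = Cexp (partial_sum u M).
Proof.
  intros Hf. induction M as [|M IH]; simpl.
  - symmetry. apply Cexp_0.
  - rewrite IH, Cexp_plus, Hf by lia. reflexivity.
Qed.

Close Scope R_scope.

Theorem theorem7 (zeta : C -> C) (Hzeta : is_riemann_zeta zeta)
    (c : nat) (Hc : (2 <= c)%nat) (s : C) (Hs : (0 < Re s)%R) :
  holomorphic_at (zeta_c zeta c) s /\
  is_infinite_prod
    (fun n : nat => nat_Cpow n (RtoC (-1) * RtoC (a_coef c n) / nat_Cpow n s))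
    (Cexp (C_derive (zeta_c zeta c) s)).
Proof.
  assert (Hc1 : (1 <= c)%nat) by lia.
  destruct (dirichlet_series_derive (zeta_c_coef c) (INR c)) with (s := s) as [l [Hl Hd]];
    [intros n; apply partial_sum_zeta_c_coef_bound, Hc1 | exact Hs |].
  assert (Hz : @is_derive C_AbsRing C_NormedModule (zeta_c zeta c) s l).
  { apply (is_derive_ext_loc (V := C_NormedModule) (dirichlet_series (zeta_c_coef c))); [|exact Hd].
    exists (mkposreal (Re s) Hs). intros w Hw. symmetry.
    apply zeta_c_eq_dirichlet_series; [exact Hzeta | exact Hc1 |].
    pose proof (Rle_lt_trans _ _ _ (re_le_Cmod (w - s)) Hw) as H.
    unfold Cminus in H. rewrite re_plus, re_opp in H. simpl in H.
    apply Rabs_lt_between in H. lra. }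
  split; [exists l; exact Hz|].
  rewrite (is_C_derive_unique _ _ _ Hz).
  apply Cconverges_filterlim. intros eps Heps.
  destruct (holomorphic_at_continuous _ _ (holomorphic_at_Cexp l) eps Heps) as [d [Hd0 Hcont]].
  destruct (Hl d Hd0) as [N HN]. exists N. intros n Hn.
  rewrite (partial_prod_Cexp _ (fun n => zeta_c_coef c n * - (ln (INR n) * Cexp (ln (INR n) * - s)))).
  - apply Hcont, (HN n Hn).
  - intros j _. unfold nat_Cpow at 1. unfold Cdiv. rewrite inv_nat_Cpow. f_equal.
    unfold zeta_c_coef. ring.
Qed.
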